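(* Let $X$ be a locally compact metric space and let $\alpha,\beta_1,\dots,\beta_n\in(0,1]$ be constants with $\alpha+\beta_1+\dots+\beta_n>n$. Then for every locally normal current $T\in\mathbf N_{n,\mathrm{loc}}(X)$ there is a unique extension of $T$ to a function $$\bar T:\mathrm{H}^\alpha_c(X)\times \mathrm{H}^{\beta_1}_{\mathrm{loc}}(X)\times\dots\times \mathrm{H}^{\beta_n}_{\mathrm{loc}}(X)\to\mathbb R$$ such that: (1) $\bar T$ is $(n+1)$-linear; (2) $\bar T(f,\pi^1,\dots,\pi^n)=0$ if some $\pi^i$ is constant on a neighborhood of $\operatorname{spt}(f)$; (3) $\bar T$ is continuous in the sense that $\bar T(f_j,\pi_j)\to\bar T(f,\pi)$ for $j\to\infty$ whenever $(f_j)_{j\in\mathbb N}$ and $(\pi^i_j)_{j\in\mathbb N}$, $i=1,\dots,n$, are sequences satisfying: (a) $f_j$ converges uniformly to $f$, the Hölder constants $\mathrm{H}^\alpha(f_j)$ are bounded in $j$, and there is a compact set containing $\operatorname{spt}(f_j)$ for all $j$; (b) for every compact set $K\subset X$ the Hölder constants $\mathrm{H}^{\beta_i}(\pi^i_j|_K)$ are bounded in $j$ and $\pi^i_j|_K$ converges uniformly to $\pi^i|_K$.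
   Context: For a metric space $X$ and $\alpha\in(0,1]$, $\mathrm{H}^\alpha(X)$ is the set of $f:X\to\mathbb R$ with $|f(x)-f(x')|\le C\,d(x,x')^\alpha$ for some $C<\infty$ and all $x,x'$; the smallest such $C$ is $\mathrm{H}^\alpha(f)$. $\mathrm{H}^\alpha_c(X)$: those with compact support; $\mathrm{H}^\alpha_{\mathrm{loc}}(X)$: functions Hölder of order $\alpha$ near every point (equivalently, $X$ being locally compact, on every compact set). $\operatorname{Lip},\operatorname{Lip}_c,\operatorname{Lip}_{\mathrm{loc}}$ denote the case $\alpha=1$; one has $\operatorname{Lip}_c(X)\subset \mathrm{H}^\alpha_c(X)$ and $\operatorname{Lip}_{\mathrm{loc}}(X)\subset \mathrm{H}^\alpha_{\mathrm{loc}}(X)$. Currents (in the sense of Lang): for a locally compact metric space $X$ let $\mathcal D^n(X)=\operatorname{Lip}_c(X)\times\prod_{i=1}^n\operatorname{Lip}_{\mathrm{loc}}(X)$. An $n$-dimensional current, $T\in\mathcal D_n(X)$, is a function $T:\mathcal D^n(X)\to\mathbb R$ that is $(n+1)$-linear; local, i.e. (if $n\ge1$) $T(f,\pi^1,\dots,\pi^n)=0$ whenever some $\pi^i$ is constant on a neighborhood of $\operatorname{spt}(f)$; and continuous, i.e. $T(f_j,\pi_j)\to T(f,\pi)$ whenever $f_j\to f$ uniformly with $\operatorname{Lip}(f_j)$ bounded and all $\operatorname{spt}(f_j)$ in a common compact set, and for every compact $K$ and every $i$, $\operatorname{Lip}(\pi^i_j|_K)$ is bounded in $j$ and $\pi^i_j|_K\to\pi^i|_K$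 uniformly. For $n\ge1$ the boundary $\partial T\in\mathcal D_{n-1}(X)$ is $\partial T(f,\pi^1,\dots,\pi^{n-1}):=T(\sigma,f,\pi^1,\dots,\pi^{n-1})$ for any $\sigma\in\operatorname{Lip}_c(X)$ with $\sigma=1$ on a neighborhood of $\operatorname{spt}(f)$. For open $V\subset X$, the mass $\mathbf M_V(T)$ is the least $M\in[0,\infty]$ with $\sum_{\lambda\in\Lambda}T(f_\lambda,\pi_\lambda)\le M$ whenever $\Lambda$ is finite, $(f_\lambda,\pi_\lambda)\in\mathcal D^n(X)$, $\operatorname{spt}(f_\lambda)\subset V$, $\sum_\lambda|f_\lambda|\le1$ and every $\pi^i_\lambda$ is $1$-Lipschitz. $\mathbf N_V(T):=\mathbf M_V(T)+\mathbf M_V(\partial T)$ if $n\ge1$ and $\mathbf N_V(T):=\mathbf M_V(T)$ if $n=0$. $\mathbf N_{n,\mathrm{loc}}(X)$ is the set of $T\in\mathcal D_n(X)$ with $\mathbf N_V(T)<\infty$ for all open $V\subset X$ with compact closure. *)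

(* Defs.v *)
From HB Require Import structures.
From mathcomp Require Import all_boot all_order all_algebra.
From mathcomp Require Import all_classical all_reals all_analysis.
From mathcomp Require Import ring.
Import Order.TTheory GRing.Theory Num.Theory.
Import numFieldNormedType.Exports.
Set Implicit Arguments.
Unset Strict Implicit.
Unset Printing Implicit Defensive.
Local Open Scope classical_set_scope.
Local Open Scope ring_scope.

Section currents.
Context {R : realType} {X : metricType R}.
Implicit Types (f g p q : X -> R) (A K U V : set X) (C a : R).

Definition spt f : set X := closure [set x | f x != 0].

Definition hoelder_bound C a A f :=
  forall x y, A x -> A y -> `|f x - f y| <= C * mdist x y `^ a.

(** The least constant, for the restriction of [f] to [A]; it is [+oo] when
    there is none.  Requiring [0 <= C] only matters when [A] has at most one
    point. *)
Definition hoelder_const a A f : \bar R :=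
  ereal_inf [set C%:E | C in [set C | 0 <= C /\ hoelder_bound C a A f]].

Lemma hoelder_constP C a A f : 0 <= C ->
  (hoelder_const a A f <= C%:E)%E <-> hoelder_bound C a A f.
Proof.
move=> C0; split=> [fC x y Ax Ay|fC]; last first.
  by apply: ge_ereal_inf; exists C%:E => //; exists C.
apply/ler_addgt0Pr => e e0; set D := mdist x y `^ a.
have D0 : 0 < 1 + D by rewrite ltr_wpDr ?powR_ge0.
have /ereal_inf_lt[_ [C' [_ fC'] <-]] :
    (hoelder_const a A f < (C + e / (1 + D))%:E)%E.
  by rewrite (le_lt_trans fC)// lte_fin ltrDl divr_gt0.
rewrite lte_fin => /ltW C'C; rewrite (le_trans (fC' _ _ Ax Ay))//.
rewrite (le_trans (ler_wpM2r (powR_ge0 _ _) C'C))// mulrDl lerD2l -/D.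
by rewrite mulrAC ler_pdivrMr// ler_pM2l// lerDr.
Qed.

Definition hoelder_c a f :=
  (exists C, hoelder_bound C a setT f) /\ compact (spt f).

Definition hoelder_loc a f :=
  forall x : X, exists2 U, nbhs x U & exists C, hoelder_bound C a U f.

Definition constant_near A p :=
  exists U c, [/\ open U, A `<=` U & forall x, U x -> p x = c].

(** Functionals are total functions of arbitrary real functions on [X]; only
    their values on the intended domain, [hoelder_dom a b] below, carry
    meaning. *)
Definition functional n := (X -> R) -> ('I_n -> X -> R) -> R.

Section functional.
Context {n : nat}.
Implicit Types (b : 'I_n -> R) (pi : 'I_n -> X -> R) (T : functional n).

Definition hoelder_dom a b f pi :=
  hoelder_c a f /\ forall i, hoelder_loc (b i) (pi i).

Definition multilinear_on a b T :=
  (forall c f g pi, hoelder_dom a b f pi -> hoelder_c a g ->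
    T (fun x => c * f x + g x) pi = c * T f pi + T g pi) /\
  (forall i c p q f pi, hoelder_dom a b f pi ->
    hoelder_loc (b i) p -> hoelder_loc (b i) q ->
    T f (dfwith pi i (fun x => c * p x + q x)) =
      c * T f (dfwith pi i p) + T f (dfwith pi i q)).

Definition local_on a b T :=
  forall f pi, hoelder_dom a b f pi ->
    (exists i, constant_near (spt f) (pi i)) -> T f pi = 0.

Definition hoelder_cvg a b (f_ : nat -> X -> R) (pi_ : nat -> 'I_n -> X -> R)
    f pi :=
  [/\ {uniform, f_ @ \oo --> f},
      exists C, forall j, (hoelder_const a setT (f_ j) <= C%:E)%E,
      exists2 K, compact K & forall j, spt (f_ j) `<=` K &
      forall K i, compact K ->
        (exists C, forall j, (hoelder_const (b i) K (pi_ j i) <= C%:E)%E) /\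
        {uniform K, (fun j => pi_ j i) @ \oo --> pi i}].

Definition continuous_on a b T :=
  forall (f_ : nat -> X -> R) (pi_ : nat -> 'I_n -> X -> R) f pi,
    (forall j, hoelder_dom a b (f_ j) (pi_ j)) -> hoelder_dom a b f pi ->
    hoelder_cvg a b f_ pi_ f pi ->
    T (f_ j) (pi_ j) @[j --> \oo] --> T f pi.

Definition current T :=
  [/\ multilinear_on 1 (fun=> 1) T, local_on 1 (fun=> 1) T &
      continuous_on 1 (fun=> 1) T].

Definition mass T V : \bar R :=
  ereal_inf [set M | (0 <= M)%E /\
    forall m (f : 'I_m -> X -> R) (pi : 'I_m -> 'I_n -> X -> R),
      (forall l, hoelder_dom 1 (fun=> 1) (f l) (pi l)) ->
      (forall l, spt (f l) `<=` V) ->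
      (forall x, \sum_l `|f l x| <= 1) ->
      (forall l i, hoelder_bound 1 1 setT (pi l i)) ->
      ((\sum_l T (f l) (pi l))%:E <= M)%E].

End functional.

Definition cons_fun n f (pi : 'I_n -> X -> R) : 'I_n.+1 -> X -> R :=
  fun i => if unlift ord0 i is Some j then pi j else f.

Definition cutoff f : set (X -> R) :=
  [set s | hoelder_c 1 s /\
    exists U, [/\ open U, spt f `<=` U & forall x, U x -> s x = 1]].

(** Independent of the chosen cut-off function for a current [T]; see
    [boundaryE]. *)
Definition boundary n (T : functional n.+1) : functional n :=
  fun f pi => T (xget (fun=> 0) (cutoff f)) (cons_fun f pi).

Lemma boundaryE n (T : functional n.+1) s f (pi : 'I_n -> X -> R) :
  current T -> hoelder_dom 1 (fun=> 1) f pi -> cutoff f s ->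
  boundary T f pi = T s (cons_fun f pi).
Proof.
move=> [[Tlin _] Tloc _] [[[C fC] _] Dpi] fs; rewrite /boundary.
have := xgetI (fun=> 0) fs; move: (xget _ _) => s' {}fs'.
move: fs fs' => [[[D sD] cs] [U [oU fU sU]]] [[[D' sD'] cs'] [U' [oU' fU' sU']]].
have Df i : hoelder_loc 1 (cons_fun f pi i).
  rewrite /cons_fun; case: unliftP => [j _|_]; first exact: Dpi.
  by move=> x; exists setT; [exact: filterT|exists C].
have ss' : hoelder_c 1 (fun x => -1 * s' x + s x).
  split.
    exists (D' + D) => x y _ _; rewrite mulrDl !mulN1r.
    have -> : - s' x + s x - (- s' y + s y) = (s' y - s' x) + (s x - s y)
      by ring.
    rewrite (le_trans (ler_normD _ _))// lerD//; last exact: sD.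
    by rewrite distrC; exact: sD'.
  apply: (@subclosed_compact _ _ (spt s' `|` spt s)).
  - exact: closed_closure.
  - exact: compactU.
  - rewrite -closureU; apply: closureS => x /=.
    apply: contraPP => /not_orP[/negP + /negP].
    by rewrite !negbK => /eqP -> /eqP ->; rewrite mulr0 addr0 eqxx.
have : T (fun x => -1 * s' x + s x) (cons_fun f pi) = 0.
  apply: Tloc; first by split.
  exists ord0, (~` spt f), 0; split.
  - by rewrite openC; exact: closed_closure.
  - move=> x + fx; have UU'x : nbhs x (U `&` U').
      apply: open_nbhs_nbhs; split; first exact: openI.
      by split; [exact: fU|exact: fU'].
    move=> /(_ _ UU'x)[y [/= + [Uy U'y]]].
    by rewrite sU// sU'// mulr1 addNr eqxx.
  - move=> x fx; rewrite /cons_fun unlift_none; apply: contrapT => /eqP fx0.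
    by apply: fx; exact: subset_closure.
rewrite Tlin; [|by do 2 split => //; exists D'|by split => //; exists D].
by move=> /eqP; rewrite mulN1r addrC subr_eq0 => /eqP.
Qed.

Definition normal_mass n : functional n -> set X -> \bar R :=
  match n with
  | 0 => fun T V => mass T V
  | _.+1 => fun T V => (mass T V + mass (boundary T) V)%E
  end.

Definition locally_normal n (T : functional n) :=
  current T /\
  forall V, open V -> compact (closure V) -> (normal_mass T V < +oo)%E.

Definition hoelder_extension n a (b : 'I_n -> R) (T Tbar : functional n) :=
  [/\ forall f pi, hoelder_dom 1 (fun=> 1) f pi -> Tbar f pi = T f pi,
      multilinear_on a b Tbar, local_on a b Tbar & continuous_on a b Tbar].

End currents.
Arguments functional {R} X n.

(* Main.v *)
(* For Lipschitz arguments the product rule holds, by cutting [f] along the values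
   of [p] into pieces on which [p] is nearly constant and using finite mass. As the
   boundary of [T] has finite mass too, it satisfies the same rule, whence [T] is
   alternating, and integration by parts gives
   [|T(f, .., h, ..)| <= (M(T) Lip f + M(dT) sup|f|) sup|h| prod Lip(pi^j)], where
   only the size of [h] enters.
   Smooth [f] and the [pi^i] at scale [e]: Lipschitz constants are of order
   [e^(a-1)] and [e^(b_i-1)], sup-errors of order [e^a] and [e^(b_i)]. Replacing one
   such approximation by another, one argument at a time, changes [T] by
   [O(e^(a + sum b_i - n))]. As the exponent is positive, the values along
   [e = 2^-k] converge geometrically, at a rate that depends only on the Hölder
   bounds; this defines the extension, and all its properties follow by comparing
   approximations. *)
Require Import Defs.
From mathcomp Require Import all_boot all_order all_algebra.
From mathcomp Require Import all_classical all_reals all_analysis.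
From mathcomp Require Import ring lra.
Import Order.TTheory GRing.Theory Num.Theory.
Import numFieldNormedType.Exports.
Set Implicit Arguments.
Unset Strict Implicit.
Unset Printing Implicit Defensive.
Local Open Scope classical_set_scope.
Local Open Scope ring_scope.

(** * Hölder calculus *)

Section hoelder_calculus.
Context {R : realType} {X : metricType R}.
Implicit Types (f g : X -> R) (A K U : set X) (C D L a c : R).

(** Mass tests only globally Lipschitz arguments and is finite only over relatively compact sets,
    whereas the [pi i] are merely locally Hölder. Locality bridges the gap: arguments may be
    multiplied by a plateau, or truncated, away from the support of [f] without changing [T].
    Integration by parts acts directly in the first slot only; alternation is what brings the other
    slots there. The comparison of two approximations never asks how they arose, and its constant
    depends on the data only through a compact set and a Hölder bound. A linear combination of
    approximations, a constant argument, a Lipschitz pair itself, or an approximation of a limit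
    reused for late members of a sequence are therefore all admissible, and each property of the
    extension becomes an estimate at one scale. Uniqueness asks for more: the smoothed functions
    have to converge in the sense of (3), so smoothing must also keep the Hölder constants
    bounded. *)

Lemma hoelder_bound_le C D a A f : C <= D ->
  hoelder_bound C a A f -> hoelder_bound D a A f.
Proof.
move=> CD fC x y Ax Ay; apply: le_trans (fC _ _ Ax Ay) _.
by rewrite ler_wpM2r// powR_ge0.
Qed.

Lemma hoelder_bound_sub C a A B f : A `<=` B ->
  hoelder_bound C a B f -> hoelder_bound C a A f.
Proof. by move=> AB fC x y /AB Ax /AB Ay; exact: fC. Qed.

Lemma hoelder_bound_cst a A c : hoelder_bound 0 a A (fun=> c).
Proof. by move=> x y _ _; rewrite subrr normr0 mul0r. Qed.

Lemma hoelder_bound_lin C D a A c f g :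
  hoelder_bound C a A f -> hoelder_bound D a A g ->
  hoelder_bound (`|c| * C + D) a A (fun x => c * f x + g x).
Proof.
move=> fC gD x y Ax Ay; rewrite mulrDl -mulrA.
have -> : c * f x + g x - (c * f y + g y) = c * (f x - f y) + (g x - g y)
  by ring.
rewrite (le_trans (ler_normD _ _))// normrM lerD ?gD//.
by rewrite ler_wpM2l ?fC.
Qed.

Lemma hoelder_boundM C D S S' a A f g :
  (forall x, A x -> `|f x| <= S) -> (forall x, A x -> `|g x| <= S') ->
  hoelder_bound C a A f -> hoelder_bound D a A g ->
  hoelder_bound (S * D + S' * C) a A (fun x => f x * g x).
Proof.
move=> fS gS fC gD x y Ax Ay; rewrite mulrDl.
have -> : f x * g x - f y * g y = f x * (g x - g y) + g y * (f x - f y)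
  by ring.
rewrite (le_trans (ler_normD _ _))// !normrM -!mulrA lerD//.
- by rewrite ler_pM ?fS ?gD.
- by rewrite ler_pM ?gS ?fC.
Qed.

Lemma hoelder_bound_comp (phi : R -> R) k C a A f : 0 <= k ->
  (forall s t, `|phi s - phi t| <= k * `|s - t|) ->
  hoelder_bound C a A f -> hoelder_bound (k * C) a A (fun x => phi (f x)).
Proof.
move=> k0 phik fC x y Ax Ay; rewrite (le_trans (phik _ _))// -mulrA.
by rewrite ler_wpM2l// fC.
Qed.

Lemma lip_boundP C A f : hoelder_bound C 1 A f <->
  forall x y, A x -> A y -> `|f x - f y| <= C * mdist x y.
Proof.
by split=> fC x y Ax Ay; have := fC _ _ Ax Ay; rewrite powRr1// mdist_ge0.
Qed.

(** Up to distance [1] one has [d <= d^a]; beyond it [d^a >= 1], and the oscillation is at most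
    [2 S]. *)
Lemma lip_hoelder S L a A f : 0 < a <= 1 -> 0 <= L ->
  (forall x, A x -> `|f x| <= S) -> hoelder_bound L 1 A f ->
  hoelder_bound (S *+ 2 + L) a A f.
Proof.
move=> /andP[a0 a1] L0 fS /lip_boundP fL x y Ax Ay.
have S0 : 0 <= S by rewrite (le_trans _ (fS _ Ax)).
have d0 : 0 <= mdist x y by exact: mdist_ge0.
have [d1|d1] := leP (mdist x y) 1.
  have dd : mdist x y <= mdist x y `^ a.
    move: d0; rewrite le_eqVlt => /predU1P[<-|d0]; first exact: powR_ge0.
    by rewrite ger1_powR// d0.
  rewrite (le_trans (fL _ _ Ax Ay))// mulrDl (le_trans (ler_wpM2l L0 dd))//.
  by rewrite lerDr mulr_ge0// ?powR_ge0// mulrn_wge0.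
have d1' : 1 <= mdist x y `^ a.
  by rewrite -(powRr0 (mdist x y)) ler_powR// ltW.
rewrite (@le_trans _ _ (S *+ 2))//.
  by rewrite (le_trans (ler_normB _ _))// mulr2n lerD// fS.
rewrite (@le_trans _ _ (S *+ 2 * mdist x y `^ a))//.
  by rewrite ler_peMr// mulrn_wge0.
by rewrite ler_wpM2r ?powR_ge0// lerDl.
Qed.

Lemma hoelder_bound_continuous C a f : 0 < a -> 0 <= C ->
  hoelder_bound C a setT f -> continuous f.
Proof.
move=> a0 C0 fC x; apply/cvgrPdist_lt => e e0.
have D0 : 0 < 1 + C by rewrite ltr_wpDr.
set r := (e / (1 + C)) `^ a^-1.
have r0 : 0 < r by rewrite powR_gt0// divr_gt0.
near=> y.
have xyr : mdist x y < r.
  by near: y; have := nbhsx_ballx x _ r0; rewrite ballEmdist.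
rewrite (le_lt_trans (fC _ _ _ _))//.
have ra : r `^ a = e / (1 + C).
  by rewrite /r -powRrM mulVf ?gt_eqF// powRr1// ltW// divr_gt0.
have xya : mdist x y `^ a <= e / (1 + C).
  by rewrite -ra ge0_ler_powR// ?nnegrE ?mdist_ge0// ltW.
rewrite (le_lt_trans (ler_wpM2l C0 xya))// mulrCA -[ltRHS]mulr1 ltr_pM2l//.
by rewrite ltr_pdivrMr// mul1r ltrDr.
Unshelve. all: by end_near.
Qed.

(** Truncation is [1]-Lipschitz and fixes small values. By locality, an argument that is small only
    near the support can thus be replaced with one that is small everywhere, as the mass estimates
    demand. *)
Definition clamp (d t : R) := Num.max (- d) (Num.min d t).

Lemma maxr_lip c s t : `|Num.max c s - Num.max c t| <= `|s - t|.
Proof.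
have h1 := ler_norm (s - t); have := ler_norm (- (s - t)).
rewrite normrN => h2; rewrite ler_norml.
by case: (leP c s) => cs; case: (leP c t) => ct; apply/andP; split; lra.
Qed.

Lemma minr_lip c s t : `|Num.min c s - Num.min c t| <= `|s - t|.
Proof.
have := maxr_lip (- c) (- s) (- t).
by rewrite -!oppr_min -!opprD !normrN.
Qed.

Lemma clamp_lip d s t : `|clamp d s - clamp d t| <= `|s - t|.
Proof. by rewrite (le_trans (maxr_lip _ _ _))// minr_lip. Qed.

Lemma clamp_le d t : 0 <= d -> `|clamp d t| <= d.
Proof.
move=> d0; rewrite /clamp ler_norml le_max lexx/= ge_max ge_min lexx/= andbT.
by rewrite (le_trans _ d0)// oppr_le0.
Qed.

Lemma clamp_id d t : `|t| <= d -> clamp d t = t.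
Proof.
by rewrite /clamp ler_norml => /andP[dt td]; rewrite (min_idPr td) (max_idPr dt).
Qed.

Lemma clamp_bound C a A d f :
  hoelder_bound C a A f -> hoelder_bound C a A (fun x => clamp d (f x)).
Proof.
move=> fC; rewrite -[C]mul1r; apply: hoelder_bound_comp => // s t.
by rewrite mul1r clamp_lip.
Qed.

(** Boundedness makes the class stable under products, which the product rule needs. *)
Definition bounded_lip f := exists C, [/\ 0 < C, forall x, `|f x| <= C &
  hoelder_bound C 1 setT f].

Lemma bounded_lipW S L f : (forall x, `|f x| <= S) ->
  hoelder_bound L 1 setT f -> bounded_lip f.
Proof.
move=> fS fL; exists (`|S| + `|L| + 1); split.
- by rewrite ltr_wpDl// addr_ge0.
- move=> x; rewrite (le_trans (fS _))// (le_trans (ler_norm _))//.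
  by rewrite -addrA lerDl addr_ge0.
- apply: hoelder_bound_le fL; rewrite (le_trans (ler_norm _))//.
  by rewrite addrAC lerDr addr_ge0.
Qed.

Lemma bounded_lip_cst c : bounded_lip (fun=> c).
Proof.
by apply: (@bounded_lipW `|c| 0) => //; exact: hoelder_bound_cst.
Qed.

Lemma bounded_lip_lin c f g : bounded_lip f -> bounded_lip g ->
  bounded_lip (fun x => c * f x + g x).
Proof.
move=> [C [C0 fC fL]] [D [D0 gD gL]].
apply: (@bounded_lipW (`|c| * C + D)); last exact: hoelder_bound_lin fL gL.
move=> x.
by rewrite (le_trans (ler_normD _ _))// lerD ?gD// normrM ler_wpM2l.
Qed.

Lemma bounded_lipD f g : bounded_lip f -> bounded_lip g ->
  bounded_lip (fun x => f x + g x).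
Proof.
have -> : (fun x => f x + g x) = (fun x => 1 * f x + g x).
  by apply/funext => x; rewrite mul1r.
exact: bounded_lip_lin.
Qed.

Lemma bounded_lipM f g : bounded_lip f -> bounded_lip g ->
  bounded_lip (fun x => f x * g x).
Proof.
move=> [C [C0 fC fL]] [D [D0 gD gL]].
apply: (@bounded_lipW (C * D)); last exact: hoelder_boundM fL gL.
by move=> x; rewrite normrM ler_pM.
Qed.

Lemma bounded_lip_clamp d f : 0 <= d -> (exists L, hoelder_bound L 1 setT f) ->
  bounded_lip (fun x => clamp d (f x)).
Proof.
move=> d0 [L fL]; apply: (@bounded_lipW d) (clamp_bound d fL) => x.
exact: clamp_le.
Qed.

Lemma bounded_lip_hoelder a f : 0 < a <= 1 -> bounded_lip f ->
  exists C, hoelder_bound C a setT f.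
Proof.
move=> a01 [C [C0 fC fL]]; exists (C *+ 2 + C); apply: lip_hoelder => //.
exact: ltW.
Qed.

Lemma hoelder_bound_loc C a f : hoelder_bound C a setT f -> hoelder_loc a f.
Proof. by move=> fC x; exists setT; [exact: filterT|exists C]. Qed.

Lemma bounded_lip_loc a f : 0 < a <= 1 -> bounded_lip f -> hoelder_loc a f.
Proof.
by move=> a01 /(bounded_lip_hoelder a01)[C]; exact: hoelder_bound_loc.
Qed.

End hoelder_calculus.

(** * Supports and cut-off functions *)

Section supports.
Context {R : realType} {X : metricType R}.
Implicit Types (f g : X -> R) (A K U : set X) (a c : R).

Lemma spt_notin f x : ~ spt f x -> f x = 0.
Proof.
by move=> fx; apply: contrapT => /eqP fx0; apply: fx; exact: subset_closure.
Qed.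

Lemma spt_subset K f : closed K -> (forall x, ~ K x -> f x = 0) -> spt f `<=` K.
Proof.
move=> cK Kf; rewrite [X in _ `<=` X](closure_id K).1//; apply: closureS => x /= fx0.
by apply: contrapT => /Kf fx; rewrite fx eqxx in fx0.
Qed.

Lemma spt_le f g : (forall x, f x = 0 -> g x = 0) -> spt g `<=` spt f.
Proof.
move=> fg; apply: spt_subset; first exact: closed_closure.
by move=> x /spt_notin/fg.
Qed.

Lemma closed_compact K : compact K -> closed K.
Proof. by apply: compact_closed; exact: metric_hausdorff. Qed.

Lemma compact_spt K f : compact K -> spt f `<=` K -> compact (spt f).
Proof.
by move=> cK; apply: subclosed_compact => //; exact: closed_closure.
Qed.

Lemma spt_lin c f g : spt (fun x => c * f x + g x) `<=` spt f `|` spt g.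
Proof.
apply: spt_subset; first by apply: closedU; exact: closed_closure.
by move=> x /not_orP[/spt_notin -> /spt_notin ->]; rewrite mulr0 addr0.
Qed.

Lemma sptMl f g : spt (fun x => f x * g x) `<=` spt f.
Proof. by apply: spt_le => x ->; rewrite mul0r. Qed.

Lemma hoelder_c_lin a c f g : hoelder_c a f -> hoelder_c a g ->
  hoelder_c a (fun x => c * f x + g x).
Proof.
move=> [[C fC] cf] [[D gD] cg]; split.
  by exists (`|c| * C + D); exact: hoelder_bound_lin.
by apply: compact_spt (@spt_lin c f g); exact: compactU.
Qed.

Lemma hoelder_loc_lin a c f g : hoelder_loc a f -> hoelder_loc a g ->
  hoelder_loc a (fun x => c * f x + g x).
Proof.
move=> fa ga x; have [U xU [C fC]] := fa x; have [V xV [D gD]] := ga x.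
exists (U `&` V); first exact: filterI.
exists (`|c| * C + D); apply: hoelder_bound_lin.
- by apply: hoelder_bound_sub fC => y [].
- by apply: hoelder_bound_sub gD => y [].
Qed.

Lemma hoelder_loc_cst a c : hoelder_loc a ((fun=> c) : X -> R).
Proof. by apply: (@hoelder_bound_loc _ _ 0); exact: hoelder_bound_cst. Qed.

(** One parameter [i] serves as Hölder constant, sup bound and inverse radius, so compactness along
    [i] tending to [+oo] makes all three uniform at once. Points at distance [d >= 1/i] are handled
    by [2 i <= 2 i (i d)^a], whence the second summand of the constant. *)
Lemma hoelder_loc_compact a f K : 0 < a -> hoelder_loc a f -> compact K ->
  exists C, [/\ 0 < C, forall x, K x -> `|f x| <= C & hoelder_bound C a K f].
Proof.
move=> a0 fa /compact_near_coveringP cK.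
have /(cK R +oo (fun i x => [/\ 0 < i, `|f x| <= i & forall y,
    mdist x y < i^-1 -> `|f x - f y| <= i * mdist x y `^ a]) _) :
    forall x, K x -> \forall x' \near x & i \near +oo, [/\ 0 < i,
      `|f x'| <= i & forall y, mdist x' y < i^-1 ->
      `|f x' - f y| <= i * mdist x' y `^ a].
  move=> x Kx; have [U /nbhs_ballP[r /= r0 rU] [C fC]] := fa x.
  have xU : U x by apply: rU; exact: ballxx.
  near=> x' i => /=.
  have i0 : 0 < i by near: i; exact: nbhs_pinfty_gt.
  have iC : `|C| * r `^ a + `|f x| <= i.
    by near: i; exact: nbhs_pinfty_ge (num_real _).
  have iC' : C <= i by near: i; exact: nbhs_pinfty_ge (num_real _).
  have ir : (r / 2)^-1 <= i by near: i; exact: nbhs_pinfty_ge (num_real _).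
  have xx' : mdist x x' < r / 2.
    near: x'; have := @nbhsx_ballx _ _ x (r / 2).
    by rewrite ballEmdist; apply; rewrite divr_gt0.
  have Ux' : U x'.
    by apply: rU; rewrite ballEmdist/= (lt_trans xx')// ltr_pdivrMr// ltr_pMr ?ltr1n.
  split => //.
    rewrite -(subrK (f x) (f x')) (le_trans (ler_normD _ _))//.
    rewrite (@le_trans _ _ (`|C| * r `^ a + `|f x|))//.
    rewrite lerD2r (le_trans (fC _ _ Ux' xU))//.
    rewrite (le_trans (ler_wpM2r (powR_ge0 _ _) (ler_norm C)))// ler_wpM2l//.
    rewrite metric_sym ge0_ler_powR// ?nnegrE ?mdist_ge0//; try exact: ltW.
    by rewrite ltW// (lt_trans xx')// ltr_pdivrMr// ltr_pMr ?ltr1n.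
  move=> y x'y; have Uy : U y.
    apply: rU; rewrite ballEmdist/= (le_lt_trans (metric_triangle _ x' _))//.
    rewrite [r]splitr ltrD// (lt_le_trans x'y)//.
    by rewrite -[leRHS]invrK lef_pV2 ?posrE ?invr_gt0 ?divr_gt0.
  by rewrite (le_trans (fC _ _ Ux' Uy))// ler_wpM2r ?powR_ge0.
case=> [M [_ /(_ (M + 1))]]; rewrite ltrDl ltr01 => /(_ isT).
(* Positivity of [i] is known only through a point of [K], so the empty set is treated apart. *)
set i := M + 1 => KM; have [K0|/set0P[x0 Kx0]] := eqVneq K set0.
  by exists 1; split => // [x|x y]; rewrite K0.
have [i0 _ _] := KM _ Kx0.
exists (i + i *+ 2 * i `^ a); split.
- by rewrite addr_gt0// mulr_gt0 ?powR_gt0// pmulrn_rgt0.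
- move=> x /KM[_ fi _]; rewrite (le_trans fi)// lerDl mulr_ge0 ?powR_ge0//.
  by rewrite mulrn_wge0// ltW.
- move=> x y Kx Ky; have [_ fx fxy] := KM _ Kx; have [_ fy _] := KM _ Ky.
  have d0 : 0 <= mdist x y by exact: mdist_ge0.
  have [/fxy|xy] := ltP (mdist x y) i^-1.
    move=> /le_trans; apply; rewrite ler_wpM2r ?powR_ge0// lerDl.
    by rewrite mulr_ge0 ?powR_ge0// mulrn_wge0// ltW.
  rewrite (@le_trans _ _ (i *+ 2))//.
    by rewrite (le_trans (ler_normB _ _))// mulr2n lerD.
  rewrite mulrDl (@le_trans _ _ (i *+ 2 * i `^ a * mdist x y `^ a))//.
    rewrite -mulrA -powRM ?(ltW i0)// ler_peMr ?mulrn_wge0 ?(ltW i0)//.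
    rewrite -[leLHS](powRr0 (i * mdist x y)) ler_powR ?(ltW a0)//.
    by rewrite -(@divff _ i) ?gt_eqF// ler_pM2l.
  by rewrite lerDr mulr_ge0 ?powR_ge0 ?(ltW i0).
Unshelve. all: by end_near.
Qed.

Lemma hoelder_c_bounded a f : 0 < a -> hoelder_c a f ->
  exists C, [/\ 0 < C, forall x, `|f x| <= C & hoelder_bound C a setT f].
Proof.
move=> a0 [[D fD] cf].
have [C [C0 fC _]] := hoelder_loc_compact a0 (hoelder_bound_loc fD) cf.
exists (C + `|D|); split; first by rewrite ltr_wpDr.
  move=> x; have [/fC fx|/spt_notin ->] := pselect (spt f x).
    by rewrite (le_trans fx)// lerDl.
  by rewrite normr0 addr_ge0// ltW.
by apply: hoelder_bound_le fD; rewrite (le_trans (ler_norm _))// lerDr ltW.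
Qed.

Lemma hoelder_c_lip f : hoelder_c 1 f <-> bounded_lip f /\ compact (spt f).
Proof.
split=> [fc|[[C [_ _ fC]] cf]]; last by split=> //; exists C.
have [C [C0 fC fL]] := hoelder_c_bounded ltr01 fc.
by split; [exact: bounded_lipW fC fL|case: fc].
Qed.

End supports.

Section cutoffs.
Context {R : realType} {X : metricType R}.
Hypothesis lcX : locally_compact [set: X].
Implicit Types (f g chi : X -> R) (A K U V W : set X) (a c : R).

Definition plateau U chi := [/\ forall x, 0 <= chi x <= 1, bounded_lip chi,
  compact (spt chi) & spt chi `<=` U].

Lemma plateau_norm U chi x : plateau U chi -> `|chi x| <= 1.
Proof. by case=> /(_ x)/andP[c0 c1] _ _ _; rewrite ger0_norm. Qed.

Lemma plateau0 U : plateau U (fun=> 0).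
Proof.
have s0 : spt ((fun=> 0) : X -> R) `<=` set0 by apply: spt_subset closed0 _.
split=> [x||//|x /s0//]; first by rewrite lexx ler01.
  exact: bounded_lip_cst.
by apply: compact_spt s0; exact: compact0.
Qed.

Lemma plateau_max U chi1 chi2 : plateau U chi1 -> plateau U chi2 ->
  plateau U (fun x => Num.max (chi1 x) (chi2 x)).
Proof.
move=> [c1 [C [C0 _ b1]] k1 s1] [c2 [D [D0 _ b2]] k2 s2].
have ss : spt (fun x => Num.max (chi1 x) (chi2 x)) `<=` spt chi1 `|` spt chi2.
  apply: spt_subset; first by apply: closedU; exact: closed_closure.
  by move=> x /not_orP[/spt_notin -> /spt_notin ->]; rewrite maxxx.
have c12 x : 0 <= Num.max (chi1 x) (chi2 x) <= 1.
  have /andP[c10 c11] := c1 x; have /andP[c20 c21] := c2 x.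
  by rewrite le_max c10/= ge_max c11 c21.
split => //.
- apply: (@bounded_lipW _ _ 1 (C + D)) => [x|].
    by have /andP[? ?] := c12 x; rewrite ger0_norm.
  apply/lip_boundP => x y _ _; rewrite mulrDl.
  have /lip_boundP/(_ x y I I) := b1; have /lip_boundP/(_ x y I I) := b2.
  rewrite !ler_norml => /andP[h1 h2] /andP[h3 h4].
  have h5 : 0 <= C * mdist x y by rewrite mulr_ge0 ?(ltW C0) ?mdist_ge0.
  have h6 : 0 <= D * mdist x y by rewrite mulr_ge0 ?(ltW D0) ?mdist_ge0.
  by case: (leP (chi1 x) (chi2 x)) => ?; case: (leP (chi1 y) (chi2 y)) => ?;
    apply/andP; split; lra.
- by apply: compact_spt ss; exact: compactU.
- by move=> x /ss[/s1|/s2].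
Qed.

Lemma plateau_point U x : open U -> U x ->
  exists chi, plateau U chi /\ \forall y \near x, chi y = 1.
Proof.
move=> oU Ux; have [B xB [cB clB]] := lcX (x := x) I.
have xB' : nbhs x B by apply: (@filterS _ (nbhs x) _ _ B _ xB) => y /(_ I).
have /nbhs_ballP[s /= s0 sB] : nbhs x (B `&` U).
  by apply: filterI => //; exact: open_nbhs_nbhs.
(* The function is [1] up to distance [r] and [0] from [2 r] on; the last third of the radius
   absorbs the closure in [spt]. *)
pose r := s / 3; have r0 : 0 < r by rewrite divr_gt0.
pose phi t := clamp 1 (Num.max 0 (2 - r^-1 * t)).
have phi_lip t u : `|phi t - phi u| <= r^-1 * `|t - u|.
  rewrite (le_trans (clamp_lip _ _ _))// (le_trans (maxr_lip _ _ _))//.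
  have -> : 2 - r^-1 * t - (2 - r^-1 * u) = - (r^-1 * (t - u)) by ring.
  by rewrite normrN normrM gtr0_norm ?invr_gt0.
have lipd : hoelder_bound 1 1 setT (mdist x).
  apply/lip_boundP => y z _ _; rewrite mul1r ler_norml.
  have := metric_triangle x y z; have := metric_triangle x z y.
  by rewrite (metric_sym z y) => h1 h2; apply/andP; split; lra.
have phi01 t : 0 <= phi t <= 1.
  rewrite /phi /clamp le_max le_min ler01 le_max lexx/= orbT ge_max.
  by rewrite ge_min lexx andbT; lra.
pose chi y := phi (mdist x y).
have chi0 y : 2 * r <= mdist x y -> chi y = 0.
  move=> ry; rewrite /chi /phi.
  have ry' : 2 - r^-1 * mdist x y <= 0 by rewrite subr_le0 mulrC ler_pdivlMr.
  by rewrite (max_idPl ry') clamp_id// normr0 ler01.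
have chi1 y : mdist x y <= r -> chi y = 1.
  move=> ry; rewrite /chi /phi /clamp.
  have ry' : 1 <= 2 - r^-1 * mdist x y.
    have : r^-1 * mdist x y <= 1 by rewrite mulrC ler_pdivrMr// mul1r.
    by move=> ?; lra.
  have ry'' : 1 <= Num.max 0 (2 - r^-1 * mdist x y) by rewrite le_max ry' orbT.
  by rewrite (min_idPl ry'') (max_idPr _)//; lra.
have sB' : spt chi `<=` B `&` U.
  move=> y /(_ _ (nbhsx_ballx y _ r0))[z [/= z0]]; rewrite ballEmdist/= => yz.
  apply: sB; rewrite ballEmdist/=.
  have : mdist x z < 2 * r by rewrite ltNge; apply: contra z0 => /chi0/eqP.
  move=> xz; rewrite (le_lt_trans (metric_triangle x z y))// (metric_sym z).
  by move: xz yz; rewrite /r => ? ?; lra.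
exists chi; split.
- split => [y|||y /sB'[]//]; [exact: phi01| |]; last by apply: compact_spt cB _ => y /sB'[].
  apply: (@bounded_lipW _ _ 1 (r^-1 * 1)) => [y|].
    by have /andP[? ?] := phi01 (mdist x y); rewrite ger0_norm.
  by apply: hoelder_bound_comp lipd => //; rewrite invr_ge0 ltW.
- near=> y; apply: chi1; apply: ltW; near: y.
  by have := nbhsx_ballx x _ r0; rewrite ballEmdist.
Unshelve. all: by end_near.
Qed.

Lemma exists_plateau K U : compact K -> open U -> K `<=` U ->
  exists chi W, [/\ plateau U chi, open W, K `<=` W & forall x, W x -> chi x = 1].
Proof.
move=> /compact_near_coveringP cK oU KU.
(* Plateau functions are directed under [<=], so compactness, in the form of
   [near_covering], applies along the filter of their upper sets. *)
pose F : set_system (X -> R) := filter_from (plateau U) (fun chi0 =>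
  [set chi | plateau U chi /\ forall x, chi0 x <= chi x]).
have FF : Filter F.
  apply: filter_from_filter; first by exists (fun=> 0); exact: plateau0.
  move=> c1 c2 b1 b2; exists (fun x => Num.max (c1 x) (c2 x)).
    exact: plateau_max.
  move=> c [bc] cc; split; split => // x; apply: le_trans (cc x).
  - by rewrite le_max lexx.
  - by rewrite le_max lexx orbT.
have /(cK _ F (fun chi x => \forall y \near x, chi y = 1) FF)[chi0 b0] :
    forall x, K x ->
    \forall x' \near x & chi \near F, \forall y \near x', chi y = 1.
  move=> x /KU Ux; have [chi [bchi x1]] := plateau_point oU Ux.
  exists ([set y | \forall z \near y, chi z = 1],
    [set chi' | plateau U chi' /\ forall x, chi x <= chi' x]) => /=.
    by split; [exact: near_join|exists chi].
  move=> [y chi'] /= [y1 [[c01 _ _ _] cc]]; near=> z.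
  have /andP[_ z1] := c01 z; apply/eqP; rewrite eq_le z1/=.
  apply: le_trans (cc z); have -> // : chi z = 1.
  by near: z.
have b0' : plateau U chi0 /\ forall x, chi0 x <= chi0 x by [].
move=> /(_ _ b0') K1; exists chi0, (interior [set y | chi0 y = 1]); split => //.
- exact: open_interior.
- by move=> x /interior_subset.
Unshelve. all: by end_near.
Qed.

Lemma plateau_interior W chi : open W ->
  (forall x, W x -> chi x = 1) -> W `<=` interior (spt chi).
Proof.
move=> oW W1; rewrite -open_subsetE// => x Wx; apply: subset_closure => /=.
by rewrite W1// oner_eq0.
Qed.

End cutoffs.

(** * Multilinear local functionals *)

Lemma dfwithE (I : eqType) (S : Type) (f : I -> S) i x j :
  dfwith f i x j = if i == j then x else f j.
Proof. by case: eqVneq => [<-|ij]; [exact: dfwithin|exact: dfwithout]. Qed.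

Lemma dfwith_id (I : eqType) (S : Type) (f : I -> S) i : dfwith f i (f i) = f.
Proof. by apply/funext => j; rewrite dfwithE; case: eqVneq => [->|]. Qed.

Lemma dfwith_dfwith (I : eqType) (S : Type) (f : I -> S) i x y :
  dfwith (dfwith f i x) i y = dfwith f i y.
Proof. by apply/funext => j; rewrite !dfwithE; case: eqVneq. Qed.

Lemma dfwithC (I : eqType) (S : Type) (f : I -> S) i j x y : i != j ->
  dfwith (dfwith f i x) j y = dfwith (dfwith f j y) i x.
Proof.
move=> ij; apply/funext => k; rewrite !dfwithE.
by case: eqVneq => [<-|//]; rewrite (negbTE ij).
Qed.

(** Leads from [p] to [q] one entry at a time. Consecutive hybrids are both a [dfwith] of the same
    family at the same index, the form in which linearity in one slot applies. *)
Definition hybrid (S : Type) n k (p q : 'I_n -> S) (i : 'I_n) :=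
  if (i < k)%N then q i else p i.

Lemma hybrid0 (S : Type) n (p q : 'I_n -> S) : hybrid 0 p q = p.
Proof. exact/funext. Qed.

Lemma hybridn (S : Type) n (p q : 'I_n -> S) : hybrid n p q = q.
Proof. by apply/funext => i; rewrite /hybrid ltn_ord. Qed.

Lemma hybridl (S : Type) n (p q : 'I_n -> S) (i : 'I_n) :
  hybrid i p q = dfwith (hybrid i p q) i (p i).
Proof.
apply/funext => j; rewrite dfwithE; case: eqVneq => [<-|//].
by rewrite /hybrid ltnn.
Qed.

Lemma hybridr (S : Type) n (p q : 'I_n -> S) (i : 'I_n) :
  hybrid i.+1 p q = dfwith (hybrid i p q) i (q i).
Proof.
apply/funext => j; rewrite dfwithE; case: eqVneq => [<-|ij].
  by rewrite /hybrid ltnSn.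
rewrite /hybrid ltnS leq_eqVlt; case: eqVneq => [ji|//].
by move: ij; rewrite (ord_inj ji) eqxx.
Qed.

Section multilinear.
Context {R : realType} {X : metricType R} {n : nat}.
Variables (a : R) (b : 'I_n -> R) (T : functional X n).
Hypotheses (Tlin : multilinear_on a b T) (Tloc : local_on a b T).
Implicit Types (f g p q : X -> R) (pi : 'I_n -> X -> R) (c : R).

Definition hoelder_loc_fam pi := forall i, hoelder_loc (b i) (pi i).

Lemma hoelder_loc_dfwith pi i p : hoelder_loc_fam pi -> hoelder_loc (b i) p ->
  hoelder_loc_fam (dfwith pi i p).
Proof. by move=> hpi hp j; rewrite dfwithE; case: eqVneq => // <-. Qed.

Lemma hoelder_loc_hybrid k pi pi' : hoelder_loc_fam pi -> hoelder_loc_fam pi' ->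
  hoelder_loc_fam (hybrid k pi pi').
Proof. by move=> hpi hpi' j; rewrite /hybrid; case: ifP. Qed.

Lemma hoelder_c0 : hoelder_c a ((fun=> 0) : X -> R).
Proof.
split; first by exists 0; exact: hoelder_bound_cst.
by apply: compact_spt (@compact0 X) _; exact: spt_subset closed0 _.
Qed.

Lemma functionalZ c f pi : hoelder_dom a b f pi ->
  T (fun x => c * f x) pi = c * T f pi.
Proof.
move=> [hf hpi].
have T0 : T (fun=> 0) pi = 0.
  have := Tlin.1 1 (fun=> 0) (fun=> 0) pi (conj hoelder_c0 hpi) hoelder_c0.
  under eq_fun do rewrite mulr0 addr0.
  by rewrite mul1r => /eqP; rewrite -subr_eq0 opprD addrA subrr sub0r oppr_eq0 => /eqP.
have := Tlin.1 c f (fun=> 0) pi (conj hf hpi) hoelder_c0.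
by under eq_fun do rewrite addr0; rewrite T0 addr0.
Qed.

Lemma functionalD f g pi : hoelder_dom a b f pi -> hoelder_c a g ->
  T (fun x => f x + g x) pi = T f pi + T g pi.
Proof.
move=> hf hg; have := Tlin.1 1 f g pi hf hg.
by under eq_fun do rewrite mul1r; rewrite mul1r.
Qed.

Lemma functionalB f g pi : hoelder_dom a b f pi -> hoelder_c a g ->
  T (fun x => f x - g x) pi = T f pi - T g pi.
Proof.
move=> [hf hpi] hg; have := Tlin.1 (-1) g f pi (conj hg hpi) hf.
under eq_fun do rewrite mulN1r addrC.
by rewrite mulN1r addrC.
Qed.

Lemma hoelder_c_sum m (f : 'I_m -> X -> R) :
  (forall l, hoelder_c a (f l)) -> hoelder_c a (fun x => \sum_l f l x).
Proof.
elim: m f => [|m IHm] f hf.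
  by under eq_fun do rewrite big_ord0; exact: hoelder_c0.
under eq_fun do rewrite big_ord_recl -[f _ _]mul1r.
by apply: hoelder_c_lin => //; apply: IHm.
Qed.

Lemma functional_sum m (f : 'I_m -> X -> R) pi : hoelder_loc_fam pi ->
  (forall l, hoelder_c a (f l)) ->
  T (fun x => \sum_l f l x) pi = \sum_l T (f l) pi.
Proof.
move=> hpi; elim: m f => [|m IHm] f hf.
  under eq_fun do rewrite big_ord0 -[0](mul0r 0).
  by rewrite functionalZ ?mul0r ?big_ord0//; split => //; exact: hoelder_c0.
under eq_fun do rewrite big_ord_recl.
by rewrite functionalD// ?IHm ?big_ord_recl//; exact: hoelder_c_sum.
Qed.

Lemma functional_cst i c f pi : hoelder_dom a b f pi ->
  T f (dfwith pi i (fun=> c)) = 0.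
Proof.
move=> [hf hpi]; apply: Tloc.
  by split=> //; apply: hoelder_loc_dfwith => //; exact: hoelder_loc_cst.
exists i, setT, c; split => //; first exact: openT.
by move=> x _; rewrite dfwithin.
Qed.

Lemma functional_argZ i c p f pi : hoelder_dom a b f pi ->
  hoelder_loc (b i) p ->
  T f (dfwith pi i (fun x => c * p x)) = c * T f (dfwith pi i p).
Proof.
move=> hf hp.
have -> : (fun x => c * p x) = (fun x => c * p x + 0).
  by apply/funext => x; rewrite addr0.
rewrite Tlin.2//; last exact: hoelder_loc_cst.
by rewrite functional_cst// addr0.
Qed.

Lemma functional_argB i p q f pi : hoelder_dom a b f pi ->
  hoelder_loc (b i) p -> hoelder_loc (b i) q ->
  T f (dfwith pi i (fun x => p x - q x)) =
  T f (dfwith pi i p) - T f (dfwith pi i q).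
Proof.
move=> hf hp hq.
have -> : (fun x => p x - q x) = (fun x => -1 * q x + p x).
  by apply/funext => x; rewrite mulN1r addrC.
by rewrite Tlin.2// mulN1r addrC.
Qed.

Lemma functional_argD i p q f pi : hoelder_dom a b f pi ->
  hoelder_loc (b i) p -> hoelder_loc (b i) q ->
  T f (dfwith pi i (fun x => p x + q x)) =
  T f (dfwith pi i p) + T f (dfwith pi i q).
Proof.
move=> hf hp hq.
have -> : (fun x => p x + q x) = (fun x => 1 * p x + q x).
  by apply/funext => x; rewrite mul1r.
by rewrite Tlin.2// mul1r.
Qed.

Lemma functional_argsZ (L : 'I_n -> R) f pi : hoelder_dom a b f pi ->
  T f (fun i x => L i * pi i x) = (\prod_i L i) * T f pi.
Proof.
move=> hf; set pi' := fun i x => L i * pi i x.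
have hpi' : hoelder_loc_fam pi'.
  move=> i; rewrite /pi'; under eq_fun do rewrite -[_ * _]addr0.
  by apply: hoelder_loc_lin; [exact: hf.2|exact: hoelder_loc_cst].
suff H k : (k <= n)%N ->
    T f (hybrid k pi pi') = (\prod_(i < n | (i < k)%N) L i) * T f pi.
  have := H n (leqnn n); rewrite hybridn => ->.
  by congr (_ * _); apply: eq_bigl => i; rewrite ltn_ord.
elim: k => [_|k IHk kn]; first by rewrite hybrid0 big_pred0 ?mul1r.
pose i := Ordinal kn; have hh : hoelder_dom a b f (hybrid i pi pi').
  by split; [exact: hf.1|apply: hoelder_loc_hybrid => //; exact: hf.2].
rewrite -[k]/(i : nat) hybridr functional_argZ//; last exact: hf.2.
rewrite -hybridl IHk ?(ltnW kn)// mulrA; congr (_ * _).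
rewrite [RHS](bigD1 i)//=; congr (_ * _); apply: eq_bigl => j.
by rewrite ltnS [in RHS]leq_eqVlt -(inj_eq val_inj)/=; case: ltngtP.
Qed.

Lemma functional_telescope f pi pi' : hoelder_dom a b f pi ->
  hoelder_loc_fam pi' ->
  T f pi' - T f pi = \sum_(i < n) T f (dfwith (hybrid i pi pi') i
    (fun x => pi' i x - pi i x)).
Proof.
move=> hf hpi'.
have hh k : hoelder_dom a b f (hybrid k pi pi').
  by split; [exact: hf.1|apply: hoelder_loc_hybrid => //; exact: hf.2].
have E (i : 'I_n) : T f (dfwith (hybrid i pi pi') i (fun x => pi' i x - pi i x))
    = T f (hybrid i.+1 pi pi') - T f (hybrid i pi pi').
  by rewrite functional_argB//; [rewrite -hybridr -hybridl|exact: hf.2].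
under eq_bigr do rewrite E.
rewrite -(big_mkord xpredT (fun k => T f (hybrid k.+1 pi pi') -
  T f (hybrid k pi pi'))) telescope_sumr// hybrid0 hybridn.
by [].
Qed.

(** In each telescoping term the slot carrying the difference is constantly [0] on [U], so locality
    kills it. *)
Lemma functional_local f pi pi' U : hoelder_dom a b f pi ->
  hoelder_loc_fam pi' -> open U -> spt f `<=` U ->
  (forall i x, U x -> pi i x = pi' i x) -> T f pi = T f pi'.
Proof.
move=> hf hpi' oU fU UE; apply/eqP; rewrite eq_sym -subr_eq0.
rewrite functional_telescope// big1// => i _; apply: Tloc.
  split; first exact: hf.1.
  apply: hoelder_loc_dfwith; first by apply: hoelder_loc_hybrid => //; exact: hf.2.
  under eq_fun do rewrite addrC -mulN1r.
  by apply: hoelder_loc_lin => //; exact: hf.2.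
exists i, U, 0; split => // x Ux; rewrite dfwithin.
by rewrite UE// subrr.
Qed.

End multilinear.

(** * Mass and the product rule *)

Section mass_bounds.
Context {R : realType} {X : metricType R} {n : nat}.
Implicit Types (T : functional X n) (V : set X) (f g p q : X -> R).

(** Whole families are kept instead of single terms: cutting [f] into many pieces then costs no more
    than [f] itself, on which the product rule rests. [A] and the [L i] restore homogeneity. *)
Definition mass_bounded T V M := 0 <= M /\
  forall m (f : 'I_m -> X -> R) (pi : 'I_m -> 'I_n -> X -> R) A (L : 'I_n -> R),
  0 < A -> (forall i, 0 < L i) ->
  (forall l, hoelder_c 1 (f l)) -> (forall l, spt (f l) `<=` V) ->
  (forall x, \sum_l `|f l x| <= A) ->
  (forall l i, hoelder_bound (L i) 1 setT (pi l i)) ->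
  `|\sum_l T (f l) (pi l)| <= M * (A * \prod_i L i).

(** Dividing [f l] by [A] and [pi l i] by [L i] reaches the normalization in [mass]; a common sign
    [c] on all [f l] yields the absolute value. *)
Lemma mass_fin_bounded T V :
  multilinear_on 1 (fun=> 1) T -> local_on 1 (fun=> 1) T ->
  (mass T V < +oo)%E -> exists M, mass_bounded T V M.
Proof.
move=> Tlin Tloc /ereal_inf_lt[M' [M0 TM] M'oo].
have [M {M'oo} EM] : exists M, M' = M%:E.
  by case: M' M0 M'oo TM => [r||]// _ _ _; exists r.
move: M0 TM; rewrite {M'}EM lee_fin => M0 TM; exists M; split => // m f pi A L.
move=> A0 L0 hf sf fA piL.
have hpi l i : hoelder_loc 1 (pi l i) by exact: hoelder_bound_loc (piL l i).
have main c : `|c| = 1 -> c * \sum_l T (f l) (pi l) <= M * (A * \prod_i L i).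
  move=> c1; have P0 : 0 < A * \prod_i L i by rewrite mulr_gt0// prodr_gt0.
  rewrite -ler_pdivrMr//.
  have hf' l : hoelder_c 1 (fun x => c / A * f l x).
    under eq_fun do rewrite -[_ * _]addr0.
    by apply: hoelder_c_lin => //; exact: hoelder_c0.
  have hpi' l i : hoelder_bound 1 1 setT (fun x => (L i)^-1 * pi l i x).
    move=> x y _ _; rewrite -mulrBr normrM gtr0_norm ?invr_gt0// mul1r.
    by rewrite mulrC ler_pdivrMr// mulrC; exact: piL.
  have := TM m (fun l x => c / A * f l x) (fun l i x => (L i)^-1 * pi l i x).
  rewrite lee_fin => /(_ _ _ _ hpi') H.
  rewrite (le_trans _ (H _ _ _))//; last first.
  - move=> x; under eq_bigr do rewrite normrM normrM c1 mul1r normfV (gtr0_norm A0).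
    by rewrite -mulr_sumr mulrC ler_pdivrMr// mul1r.
  - move=> l; apply: subset_trans (sf l).
    by apply: spt_le => x ->; rewrite mulr0.
  - by move=> l; split=> // i; exact: hoelder_bound_loc (hpi' l i).
  rewrite le_eqVlt; apply/orP; left; apply/eqP.
  under [RHS]eq_bigr => l _.
    rewrite (functionalZ Tlin); last first.
      by split=> // i; exact: hoelder_bound_loc (hpi' l i).
    rewrite (functional_argsZ Tlin Tloc); last by split.
    over.
  rewrite -2!mulr_sumr prodfV invfM.
  by set S := \sum_i _; set Pi := \prod_i _; ring.
rewrite ler_norml lerNl; apply/andP; split.
- by rewrite -mulN1r main// normrN1.
- by rewrite -[leLHS]mul1r main// normr1.
Qed.

End mass_bounds.

(** * A piecewise linear partition of unity on the real line *)

Section ramp.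
Context {R : realType} {X : metricType R}.
Implicit Types (t : R) (f : X -> R).

Definition ramp (t : R) := Num.max 0 (Num.min 1 t).

Lemma ramp_lip s t : `|ramp s - ramp t| <= `|s - t|.
Proof. by rewrite (le_trans (maxr_lip _ _ _))// minr_lip. Qed.

Lemma ramp01 t : 0 <= ramp t <= 1.
Proof. by rewrite /ramp le_max lexx/= ge_max ler01 ge_min lexx. Qed.

Lemma ramp_le s t : s <= t -> ramp s <= ramp t.
Proof.
move=> st; rewrite /ramp ge_max le_max lexx/= le_max; apply/orP; right.
by rewrite le_min ge_min lexx/= ge_min st orbT.
Qed.

Lemma ramp_eq0 t : t <= 0 -> ramp t = 0.
Proof. by move=> t0; rewrite /ramp (min_idPr _) ?(max_idPl _)//; lra. Qed.

Lemma ramp_eq1 t : 1 <= t -> ramp t = 1.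
Proof. by move=> t1; rewrite /ramp (min_idPl _)// (max_idPr _)//; lra. Qed.

Lemma bounded_lip_ramp f : bounded_lip f -> bounded_lip (fun x => ramp (f x)).
Proof.
move=> [C [C0 _ fC]]; apply: (@bounded_lipW _ _ 1 (1 * C)) => [x|].
  by have /andP[? ?] := ramp01 (f x); rewrite ger0_norm.
by apply: hoelder_bound_comp fC => // s t; rewrite mul1r ramp_lip.
Qed.

(** The tent function supported in [[-1, 1]]. As a difference of ramps, its integer translates sum
    to [1] by telescoping. *)
Definition hat t := ramp (t + 1) - ramp t.

Lemma hat_ge0 t : 0 <= hat t.
Proof. by rewrite subr_ge0 ramp_le// lerDl. Qed.

Lemma hat_eq0 t : 1 <= `|t| -> hat t = 0.
Proof.
rewrite ler_normr /hat => /orP[t1|t1]; last by rewrite !ramp_eq0 ?subrr//; lra.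
by rewrite !ramp_eq1 ?subrr//; lra.
Qed.

Lemma sum_hat t N : 0 <= t <= N%:R -> \sum_(k < N.+1) hat (t - k%:R) = 1.
Proof.
move=> /andP[t0 tN].
rewrite (eq_bigr (fun k : 'I_N.+1 => - ramp (t + 1 - k.+1%:R) -
   - ramp (t + 1 - k%:R))) => [|k _]; last first.
  by rewrite /hat -natr1 opprK addrC; congr (- ramp _ + ramp _); ring.
rewrite -(big_mkord xpredT (fun k => - ramp (t + 1 - k.+1%:R) -
   - ramp (t + 1 - k%:R))) telescope_sumr// subr0 ramp_eq0; last first.
  by rewrite -natr1; lra.
by rewrite ramp_eq1 ?oppr0 ?sub0r ?opprK//; lra.
Qed.

End ramp.

Section product_rule.
Context {R : realType} {X : metricType R} {n : nat}.
Variables (T : functional X n) (V : set X) (M : R).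
Hypotheses (Tlin : multilinear_on 1 (fun=> 1) T)
  (Tloc : local_on 1 (fun=> 1) T) (TM : mass_bounded T V M).
Implicit Types (f g p q : X -> R) (pi : 'I_n -> X -> R).

Lemma bounded_lip_loc1 p : bounded_lip p -> hoelder_loc 1 p.
Proof. by apply: bounded_lip_loc; rewrite ltr01 lexx. Qed.

Lemma hoelder_cM f p : hoelder_c 1 f -> bounded_lip p ->
  hoelder_c 1 (fun x => f x * p x).
Proof.
move=> /hoelder_c_lip[bf cf] bp; apply/hoelder_c_lip; split.
  exact: bounded_lipM.
by apply: compact_spt cf _; exact: sptMl.
Qed.

Lemma lip_fam pi : (forall i, bounded_lip (pi i)) ->
  exists L : 'I_n -> R, (forall i, 0 < L i) /\
    forall i, hoelder_bound (L i) 1 setT (pi i).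
Proof.
move=> bpi; have /choice[L HL] : forall i, exists C, 0 < C /\
    hoelder_bound C 1 setT (pi i).
  by move=> i; have [C [C0 _ piC]] := bpi i; exists C.
by exists L; split=> i; case: (HL i).
Qed.

(** The number of pieces grows like [1/e], but the pieces satisfy [\sum_k |F k| = |f|] and the mass
    bounds the whole sum at once; hence [K] does not depend on [e]. *)
Lemma square_rule_defect f pi i p : hoelder_c 1 f -> spt f `<=` V ->
  (forall j, bounded_lip (pi j)) -> bounded_lip p ->
  exists K, 0 <= K /\ forall e : R, 0 < e ->
  `|T f (dfwith pi i (fun x => p x * p x)) -
    2 * T (fun x => f x * p x) (dfwith pi i p)| <= K * e.
Proof.
move=> hf fV bpi [P [P0 pP pL]].
have bp : bounded_lip p by exists P.
have /hoelder_c_lip[[A [A0 fA fL]] cf] := hf.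
have [L [L0 piL]] := lip_fam bpi.
have hpi : hoelder_loc_fam (fun=> 1) pi by move=> j; exact: bounded_lip_loc1.
have M0 := TM.1; pose Pi := \prod_(j < n | j != i) L j.
have Pi0 : 0 < Pi by exact: prodr_gt0.
(* Four comes from the Lipschitz constant [4 e P] of the squares of the [q k], two from the doubled
   sum over [G k], whose size is at most [e |f|]. *)
exists (M * (A * P * Pi) *+ 6); split.
  by rewrite mulrn_wge0// !mulr_ge0// ltW.
(* In units of [e], the range of [p] lies in [[0, N]], and the level [t k] corresponds to the
   integer [k]. *)
move=> e e0; pose s x := (p x + P) / e.
pose N := (Num.truncn (P *+ 2 / e)).+1.
have sN x : 0 <= s x <= N%:R.
  have := pP x; rewrite ler_norml => /andP[h1 h2].
  rewrite /s divr_ge0 ?(ltW e0)//=; last by lra.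
  rewrite (@le_trans _ _ (P *+ 2 / e))//; last first.
    by rewrite ltW// truncnS_gt.
  by rewrite ler_wpM2r ?invr_ge0 ?(ltW e0)// mulr2n lerD2r.
pose t (k : 'I_N.+1) : R := e * k%:R - P.
have pt k x : p x - t k = e * (s x - k%:R).
  by rewrite /t /s mulrBr mulrCA divff ?gt_eqF// mulr1; ring.
have bs c : bounded_lip (fun x => s x + c).
  have -> : (fun x => s x + c) = (fun x => e^-1 * p x + (P / e + c)).
    by apply/funext => x; rewrite /s; ring.
  by apply: bounded_lip_lin => //; exact: bounded_lip_cst.
pose phi (k : 'I_N.+1) x := hat (s x - k%:R).
have bphi k : bounded_lip (phi k).
  have -> : phi k = fun x => -1 * ramp (s x + (- k%:R)) + ramp (s x + (1 - k%:R)).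
    apply/funext => x; rewrite /phi /hat mulN1r addrC; congr (- ramp _ + ramp _).
    by ring.
  by apply: bounded_lip_lin; exact: bounded_lip_ramp.
have phi0 k x : 0 <= phi k x by exact: hat_ge0.
have phi1 x : \sum_k phi k x = 1 by exact: sum_hat.
(* [p] stays within [e] of the constant [t k] on the support of [F k]. *)
pose F k x := f x * phi k x.
have hF k : hoelder_c 1 (F k) by exact: hoelder_cM.
have FV k : spt (F k) `<=` V by apply: subset_trans fV; exact: sptMl.
have absF x : \sum_k `|F k x| = `|f x|.
  under eq_bigr do rewrite normrM (ger0_norm (phi0 _ _)).
  by rewrite -mulr_sumr phi1 mulr1.
(* Truncation at [2 e] instead of [e] leaves room for an open neighbourhood of [spt (F k)], which
   locality requires. *)
pose q k x := clamp (e *+ 2) (p x - t k).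
have e2 : 0 <= e *+ 2 by rewrite mulrn_wge0// ltW.
have qe k x : `|q k x| <= e *+ 2 by exact: clamp_le.
have qL k : hoelder_bound P 1 setT (q k).
  apply: clamp_bound => x y _ _ /=.
  have -> : p x - t k - (p y - t k) = p x - p y by ring.
  exact: pL.
have bq k : bounded_lip (q k) by exact: bounded_lipW (qe k) (qL k).
have bqq k : bounded_lip (fun x => q k x * q k x) by exact: bounded_lipM.
have cs c : continuous (fun x => `|s x + c|).
  have [C [C0 _ sC]] := bs c => x; apply: cvg_norm; move: x.
  by apply: hoelder_bound_continuous sC => //; exact: ltW.
(* [p^2 = (p - t)^2 + 2 t p - t^2], and [(p - t)^2] has Lipschitz constant
   [O(e)] where [|p - t| <= 2 e]. *)
have step k : T (F k) (dfwith pi i (fun x => p x * p x)) =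
    T (F k) (dfwith pi i (fun x => q k x * q k x)) +
    2 * t k * T (F k) (dfwith pi i p).
  have hFpi : hoelder_dom 1 (fun=> 1) (F k) pi by split.
  pose r x := 2 * t k * p x + (q k x * q k x + - (t k * t k)).
  have br : bounded_lip (fun x => q k x * q k x + - (t k * t k)).
    by apply: bounded_lipD => //; exact: bounded_lip_cst.
  transitivity (T (F k) (dfwith pi i r)).
    pose U := [set x | `|s x + - k%:R| < 2].
    have oU : open U.
      apply: (@open_comp _ _ (fun x => `|s x + - k%:R|) [set u | u < 2]).
        by move=> x _; exact: cs.
      exact: open_lt.
    have FU : spt (F k) `<=` U.
      apply: (@subset_trans _ [set x | `|s x + - k%:R| <= 1]); last first.
        by move=> x /= /le_lt_trans; apply; rewrite ltr1n.
      apply: spt_subset.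
        apply: (@closed_comp _ _ (fun x => `|s x + - k%:R|) [set u | u <= 1]).
          by move=> x _; exact: cs.
        exact: closed_le.
      by move=> x /= /negP; rewrite -ltNge /F /phi => /ltW/hat_eq0 ->; rewrite mulr0.
    apply: (functional_local Tlin Tloc) oU FU _.
    - split => //; apply: hoelder_loc_dfwith => //; apply: bounded_lip_loc1.
      exact: bounded_lipM.
    - apply: hoelder_loc_dfwith => //; apply: bounded_lip_loc1.
      exact: bounded_lip_lin.
    - move=> j x /= Ux; rewrite !dfwithE; case: eqP => // _.
      rewrite /r /q clamp_id; first by ring.
      by rewrite pt normrM gtr0_norm// -[e *+ 2]mulr_natr ler_pM2l// ltW.
  rewrite /r Tlin.2//; [|exact: bounded_lip_loc1|exact: bounded_lip_loc1].
  rewrite (functional_argD Tlin)//; [|exact: bounded_lip_loc1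
    |exact: hoelder_loc_cst].
  by rewrite (functional_cst Tloc)// addr0 addrC.
pose G k x := F k x * (p x - t k).
have bpt k : bounded_lip (fun x => p x - t k).
  by apply: bounded_lipD => //; exact: bounded_lip_cst.
have hG k : hoelder_c 1 (G k) by exact: hoelder_cM.
have hdp : hoelder_loc_fam (fun=> 1) (dfwith pi i p).
  by apply: hoelder_loc_dfwith => //; exact: bounded_lip_loc1.
have step' k : T (fun x => F k x * p x) (dfwith pi i p) =
    T (G k) (dfwith pi i p) + t k * T (F k) (dfwith pi i p).
  have -> : (fun x => F k x * p x) = (fun x => t k * F k x + G k x).
    by apply/funext => x; rewrite /G; ring.
  by rewrite Tlin.1// addrC.
have Ef : f = (fun x => \sum_k F k x).
  by apply/funext => x; rewrite -mulr_sumr phi1 mulr1.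
have Efp : (fun x => f x * p x) = (fun x => \sum_k F k x * p x).
  by apply/funext => x; rewrite -mulr_suml -mulr_sumr phi1 mulr1.
rewrite Efp (functional_sum Tlin)//; last by move=> k; exact: hoelder_cM.
rewrite [in T f]Ef (functional_sum Tlin)//; last first.
  apply: hoelder_loc_dfwith => //; apply: bounded_lip_loc1.
  exact: bounded_lipM.
under eq_bigr do rewrite step.
under [X in _ - 2 * X]eq_bigr do rewrite step'.
rewrite !big_split/= mulrDr.
under [X in _ + X - _]eq_bigr do rewrite -mulrA.
(* The terms [2 t_k T(F_k, p)] from both sides cancel; two sums of order [e] remain. *)
rewrite -mulr_sumr opprD addrACA subrr addr0.
have prodE c : \prod_j (if i == j then c else L j) = c * Pi.
  rewrite (bigD1 i)//= eqxx; congr (_ * _); apply: eq_bigr => j.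
  by rewrite eq_sym => /negbTE ->.
have [_ TM'] := TM.
have B1 : `|\sum_k T (F k) (dfwith pi i (fun x => q k x * q k x))| <=
    M * (A * (e *+ 4 * P * Pi)).
  rewrite -prodE; apply: TM' => //.
  - by move=> j; case: eqP => // _; rewrite mulr_gt0// pmulrn_rgt0.
  - by move=> x; rewrite absF.
  - move=> k j; rewrite dfwithE; case: eqP => // _.
    have := hoelder_boundM (fun x _ => qe k x) (fun x _ => qe k x) (qL k) (qL k).
    by congr (hoelder_bound _ _ _ _); ring.
have B2 : `|\sum_k T (G k) (dfwith pi i p)| <= M * (A * e * (P * Pi)).
  rewrite -prodE; apply: TM' => //.
  - by rewrite mulr_gt0.
  - by move=> j; case: eqP.
  - by move=> k; apply: subset_trans (FV k); exact: sptMl.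
  - move=> x; rewrite (@le_trans _ _ (\sum_k `|F k x| * e))//; last first.
      by rewrite -mulr_suml absF ler_wpM2r// ltW.
    apply: ler_sum => k _; rewrite /G normrM pt [`|e * _|]normrM (gtr0_norm e0).
    have [h|/ltW h] := leP 1 `|s x - k%:R|.
      by rewrite /F /phi hat_eq0// mulr0 normr0 !mul0r.
    by rewrite ler_wpM2l// ler_piMr// ltW.
  - by move=> k j; rewrite dfwithE; case: eqP => [_|_]; [exact: pL|exact: piL].
rewrite (le_trans (ler_normB _ _))// normrM normr_nat.
rewrite (le_trans (lerD B1 (ler_wpM2l _ B2)))//.
by rewrite le_eqVlt; apply/orP; left; apply/eqP; ring.
Qed.

Lemma square_rule f pi i p : hoelder_c 1 f -> spt f `<=` V ->
  (forall j, bounded_lip (pi j)) -> bounded_lip p ->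
  T f (dfwith pi i (fun x => p x * p x)) =
  2 * T (fun x => f x * p x) (dfwith pi i p).
Proof.
move=> hf fV bpi bp; have [K [K0 HK]] := square_rule_defect i hf fV bpi bp.
apply/eqP; rewrite -subr_eq0 -normr_le0; apply/ler_addgt0Pl => e e0.
have K1 : 0 < K + 1 by rewrite ltr_wpDl.
rewrite addr0 (le_trans (HK (e / (K + 1)) _)) ?divr_gt0//.
by rewrite mulrCA ler_piMr ?(ltW e0)// ler_pdivrMr// mul1r lerDl.
Qed.

(** Polarization: the square rule at [p + q], minus those at [p] and [q]. *)
Lemma product_rule f pi i p q : hoelder_c 1 f -> spt f `<=` V ->
  (forall j, bounded_lip (pi j)) -> bounded_lip p -> bounded_lip q ->
  T f (dfwith pi i (fun x => p x * q x)) =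
  T (fun x => f x * p x) (dfwith pi i q) +
  T (fun x => f x * q x) (dfwith pi i p).
Proof.
move=> hf fV bpi bp bq.
have hpi : hoelder_loc_fam (fun=> 1) pi by move=> j; exact: bounded_lip_loc1.
have bpq : bounded_lip (fun x => p x + q x) by exact: bounded_lipD.
have := square_rule i hf fV bpi bpq.
have -> : (fun x => (p x + q x) * (p x + q x)) =
    (fun x => 2 * (p x * q x) + (p x * p x + q x * q x)).
  by apply/funext => x; ring.
have hl (r r' : X -> R) : bounded_lip r -> bounded_lip r' ->
    hoelder_loc 1 (fun x => r x * r' x).
  by move=> br br'; apply: bounded_lip_loc1; exact: bounded_lipM.
have hd (r : X -> R) : bounded_lip r -> hoelder_loc_fam (fun=> 1) (dfwith pi i r).
  by move=> br; apply: hoelder_loc_dfwith => //; exact: bounded_lip_loc1.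
rewrite Tlin.2//; [|exact: hl|by apply: bounded_lip_loc1; apply: bounded_lipD;
  exact: bounded_lipM].
have hl1 := bounded_lip_loc1.
have hcM := hoelder_cM.
rewrite (functional_argD Tlin (p := fun x => p x * p x))//;
  [|exact: hl|exact: hl].
rewrite !(square_rule i hf fV bpi)//.
have -> : (fun x => f x * (p x + q x)) = (fun x => f x * p x + f x * q x).
  by apply/funext => x; ring.
rewrite (functionalD Tlin); [|split; [exact: hcM|exact: hd]|exact: hcM].
rewrite !(functional_argD Tlin (p := p)); try (by split => //; exact: hcM);
  try exact: hl1.
by move=> H; lra.
Qed.

End product_rule.

(** * Boundary and integration by parts *)

Lemma mass_bounded1 (R : realType) (X : metricType R) n (T : functional X n)
    V M f pi A (L : 'I_n -> R) : mass_bounded T V M ->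
  0 < A -> (forall i, 0 < L i) -> hoelder_c 1 f -> spt f `<=` V ->
  (forall x, `|f x| <= A) -> (forall i, hoelder_bound (L i) 1 setT (pi i)) ->
  `|T f pi| <= M * (A * \prod_i L i).
Proof.
move=> [_ TM] A0 L0 hf fV fA piL.
have := TM 1%N (fun=> f) (fun=> pi) A L A0 L0.
by rewrite big_ord1; apply => // x; rewrite big_ord1.
Qed.

Section cons_fun.
Context {R : realType} {X : metricType R} {n : nat}.
Implicit Types (f g p : X -> R) (pi : 'I_n -> X -> R).

Lemma cons_fun0 f pi : cons_fun f pi ord0 = f.
Proof. by rewrite /cons_fun unlift_none. Qed.

Lemma cons_funS f pi i : cons_fun f pi (lift ord0 i) = pi i.
Proof. by rewrite /cons_fun liftK. Qed.

Lemma cons_fun_dfwith0 f g pi : dfwith (cons_fun f pi) ord0 g = cons_fun g pi.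
Proof.
apply/funext => j; rewrite dfwithE; case: (unliftP ord0 j) => [i|] ->.
  by rewrite !cons_funS.
by rewrite eqxx cons_fun0.
Qed.

Lemma cons_fun_dfwithS f i p pi :
  dfwith (cons_fun f pi) (lift ord0 i) p = cons_fun f (dfwith pi i p).
Proof.
apply/funext => j; rewrite dfwithE; case: (unliftP ord0 j) => [k|] ->.
  by rewrite !cons_funS dfwithE (inj_eq lift_inj).
by rewrite !cons_fun0.
Qed.

Lemma cons_fun_eta (rho : 'I_n.+1 -> X -> R) :
  rho = cons_fun (rho ord0) (fun i => rho (lift ord0 i)).
Proof.
apply/funext => j; case: (unliftP ord0 j) => [k|] ->; first by rewrite cons_funS.
by rewrite cons_fun0.
Qed.

Lemma hoelder_loc_cons_fun f pi : hoelder_loc 1 f ->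
  hoelder_loc_fam (fun=> 1) pi -> hoelder_loc_fam (fun=> 1) (cons_fun f pi).
Proof.
move=> hf hpi j; case: (unliftP ord0 j) => [k|] ->; first by rewrite cons_funS.
by rewrite cons_fun0.
Qed.

Lemma bounded_lip_cons_fun f pi : bounded_lip f ->
  (forall i, bounded_lip (pi i)) -> forall i, bounded_lip (cons_fun f pi i).
Proof.
move=> hf hpi j; case: (unliftP ord0 j) => [k|] ->; first by rewrite cons_funS.
by rewrite cons_fun0.
Qed.

End cons_fun.

Section boundary.
Context {R : realType} {X : metricType R} {n : nat}.
Variables (T : functional X n.+1).
Hypotheses (lcX : locally_compact [set: X]) (cT : current T).
Implicit Types (f g p q : X -> R) (pi : 'I_n -> X -> R).

Let Tlin : multilinear_on 1 (fun=> 1) T. Proof. by case: cT. Qed.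
Let Tloc : local_on 1 (fun=> 1) T. Proof. by case: cT. Qed.

Lemma plateau_hoelder_c U chi : @plateau R X U chi -> hoelder_c 1 chi.
Proof. by case=> _ bchi cchi _; exact/hoelder_c_lip. Qed.

(** One cut-off serves every function supported in [K], so that [boundaryE] puts the same first
    argument into all terms of an identity. The relation [s f = f] turns terms of the product rule
    for [s] back into terms for [f]. *)
Lemma exists_cutoff (K U : set X) : compact K -> open U -> K `<=` U ->
  exists s, plateau U s /\ forall f, spt f `<=` K ->
    cutoff f s /\ forall x, s x * f x = f x.
Proof.
move=> cK oU KU; have [s [W [bs oW KW sW]]] := exists_plateau lcX cK oU KU.
exists s; split => // f fK; split.
  split; first exact: plateau_hoelder_c bs.
  by exists W; split => //; exact: subset_trans KW.
move=> x; have [/fK/KW/sW ->|/spt_notin ->] := pselect (spt f x).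
  by rewrite mul1r.
by rewrite mulr0.
Qed.

Lemma hoelder_c_loc f : hoelder_c 1 f -> hoelder_loc 1 f.
Proof. by move=> /hoelder_c_lip[/bounded_lip_loc1]. Qed.

Lemma boundary_multilinear : multilinear_on 1 (fun=> 1) (boundary T).
Proof.
split=> [c f g pi [hf hpi] hg|i c p q f pi [hf hpi] hp hq].
- have [s [bs sfg]] := exists_cutoff (compactU hf.2 hg.2) openT (@subsetT _ _).
  have hs : hoelder_c 1 s by exact: plateau_hoelder_c bs.
  have [cf _] := sfg f (@subsetUl _ _ _); have [cg _] := sfg g (@subsetUr _ _ _).
  have [cfg _] := sfg _ (@spt_lin _ _ c f g).
  rewrite !(boundaryE cT (s := s))//; last first.
    by split => //; exact: hoelder_c_lin.
  rewrite -(cons_fun_dfwith0 f (fun x => _)) Tlin.2//; try exact: hoelder_c_loc.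
    by rewrite !cons_fun_dfwith0.
  by split => //; apply: hoelder_loc_cons_fun => //; exact: hoelder_c_loc.
- have [s [bs sf]] := exists_cutoff hf.2 openT (@subsetT _ _).
  have hs : hoelder_c 1 s by exact: plateau_hoelder_c bs.
  have [cf _] := sf f (@subset_refl _ _).
  rewrite !(boundaryE cT (s := s))//; try (by split => //;
    apply: hoelder_loc_dfwith => //; exact: hoelder_loc_lin).
  rewrite -!cons_fun_dfwithS Tlin.2//.
  by split => //; apply: hoelder_loc_cons_fun => //; exact: hoelder_c_loc.
Qed.

(** The cut-off can be supported in the open set where [pi i] is constant, so locality of [T]
    applies to it in place of [f]. *)
Lemma boundary_local : local_on 1 (fun=> 1) (boundary T).
Proof.
move=> f pi [hf hpi] [i [U [c [oU fU Uc]]]].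
have [s [bs sf]] := exists_cutoff hf.2 oU fU.
have [cf _] := sf f (@subset_refl _ _).
rewrite (boundaryE cT (s := s))//; apply: Tloc.
  split; first exact: plateau_hoelder_c bs.
  by apply: hoelder_loc_cons_fun => //; exact: hoelder_c_loc.
exists (lift ord0 i), U, c; split => //; first by case: bs.
by move=> x Ux; rewrite cons_funS Uc.
Qed.

Variables (V : set X) (M M' : R).
Hypotheses (oV : open V) (TM : mass_bounded T V M)
  (TM' : mass_bounded (boundary T) V M').

(* The square rules for [boundary T] and for [T], together with the product
   rule in the first slot, evaluate [T] at [(s, f, .., p^2, ..)] in two ways. *)
Lemma functional_alternating f (pi : 'I_n.+1 -> X -> R) j p :
  hoelder_c 1 f -> spt f `<=` V ->
  (forall i, bounded_lip (pi i)) -> bounded_lip p ->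
  T f (dfwith (dfwith pi ord0 p) (lift ord0 j) p) = 0.
Proof.
move=> hf fV bpi bp; have [s [bs sf]] := exists_cutoff hf.2 oV fV.
have [bf _] := (hoelder_c_lip f).1 hf.
have hs : hoelder_c 1 s by exact: plateau_hoelder_c bs.
have sV : spt s `<=` V by case: bs.
have [cf sfE] := sf f (@subset_refl _ _).
have [cfp _] := sf _ (@sptMl _ _ f p).
set rest := fun i => pi (lift ord0 i).
have brest i : bounded_lip (rest i) by exact: bpi.
have hrest r : bounded_lip r -> hoelder_loc_fam (fun=> 1) (dfwith rest j r).
  move=> br; apply: hoelder_loc_dfwith; last exact: bounded_lip_loc1.
  by move=> i; exact: bounded_lip_loc1.
have := square_rule boundary_multilinear boundary_local TM' j hf fV brest bp.
rewrite !(boundaryE cT (s := s))//; first last.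
- by split => //; apply: hrest; exact: bounded_lipM.
- by split; [exact: hoelder_cM|exact: hrest].
have bc : forall i, bounded_lip (cons_fun f (dfwith rest j p) i).
  apply: bounded_lip_cons_fun => // i; rewrite dfwithE.
  by case: eqP.
have := product_rule Tlin Tloc TM ord0 hs sV bc bf bp.
rewrite !cons_fun_dfwith0 (_ : (fun x => s x * f x) = f); last exact/funext.
have bc' : forall i, bounded_lip (cons_fun f rest i).
  exact: bounded_lip_cons_fun.
have := square_rule Tlin Tloc TM (lift ord0 j) hs sV bc' bp.
(* Showing only slot [0] and the slot of [p]: [h3] is [T(s, f, p^2) = 2 T(s, f p, p)], [h2] is
   [T(s, f p, p) = T(f, p, p) + T(s p, f, p)], and [h1] is [T(s, f, p^2) = 2 T(s p, f, p)]. Together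
   they force [T(f, p, p) = 0]. *)
rewrite !cons_fun_dfwithS => h1 h2 h3.
rewrite [pi]cons_fun_eta cons_fun_dfwith0 cons_fun_dfwithS -/rest.
by move: h3; rewrite h1 h2; lra.
Qed.

(** Expanding the alternating identity at [p + q] leaves the two mixed terms. *)
Lemma functional_swap f (pi : 'I_n.+1 -> X -> R) j p q :
  hoelder_c 1 f -> spt f `<=` V ->
  (forall i, bounded_lip (pi i)) -> bounded_lip p -> bounded_lip q ->
  T f (dfwith (dfwith pi ord0 p) (lift ord0 j) q) =
  - T f (dfwith (dfwith pi ord0 q) (lift ord0 j) p).
Proof.
move=> hf fV bpi bp bq.
have bpq : bounded_lip (fun x => p x + q x) by exact: bounded_lipD.
have hpi : hoelder_loc_fam (fun=> 1) pi by move=> i; exact: bounded_lip_loc1.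
have hd i (r : X -> R) : bounded_lip r ->
    hoelder_dom 1 (fun=> 1) f (dfwith pi i r).
  move=> br; split => //; apply: hoelder_loc_dfwith => //.
  exact: bounded_lip_loc1.
have l1 := bounded_lip_loc1.
have := functional_alternating j hf fV bpi bpq.
rewrite (functional_argD Tlin); [|exact: hd|exact: l1|exact: l1].
have ne := neq_lift ord0 j.
rewrite !(dfwithC _ _ _ ne).
rewrite !(functional_argD Tlin (p := p)); try exact: hd; try exact: l1.
rewrite -!(dfwithC _ _ _ ne) !functional_alternating// add0r addr0 => /eqP.
by rewrite addrC addr_eq0 => /eqP.
Qed.

(* Integration by parts moves the derivative off [h], so that only its size
   matters. *)
Lemma functional_parts f (pi : 'I_n.+1 -> X -> R) (L : 'I_n.+1 -> R) A S d i h :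
  hoelder_c 1 f -> spt f `<=` V -> (forall j, bounded_lip (pi j)) ->
  bounded_lip h -> 0 < A -> 0 < S -> 0 < d -> (forall j, 0 < L j) ->
  hoelder_bound A 1 setT f -> (forall x, `|f x| <= S) ->
  (forall x, `|h x| <= d) -> (forall j, hoelder_bound (L j) 1 setT (pi j)) ->
  `|T f (dfwith pi i h)| <= (M * A + M' * S) * (d * \prod_(j | j != i) L j).
Proof.
move=> hf fV bpi bh A0 S0 d0 L0 fA fS hd piL.
have prod0 (P : 'I_n.+1 -> R) :
    \prod_(j | j != ord0) P j = \prod_(j < n) P (lift ord0 j).
  by rewrite big_mkcond big_ord_recl/= mul1r; apply: eq_bigr.
have main (rho : 'I_n.+1 -> X -> R) (P : 'I_n.+1 -> R) :
    (forall j, bounded_lip (rho j)) -> (forall j, 0 < P j) ->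
    (forall j, hoelder_bound (P j) 1 setT (rho j)) ->
    `|T f (dfwith rho ord0 h)| <=
      (M * A + M' * S) * (d * \prod_(j | j != ord0) P j).
  move=> brho P0 rhoP; have [s [bs sf]] := exists_cutoff hf.2 oV fV.
  have [bf _] := (hoelder_c_lip f).1 hf.
  have hs : hoelder_c 1 s by exact: plateau_hoelder_c bs.
  have sV : spt s `<=` V by case: bs.
  have [cfh _] := sf _ (@sptMl _ _ f h); have [_ sfE] := sf f (@subset_refl _ _).
  have := product_rule Tlin Tloc TM ord0 hs sV brho bf bh.
  rewrite (_ : (fun x => s x * f x) = f); last exact/funext.
  set rest := fun i => rho (lift ord0 i).
  have -> : dfwith rho ord0 (fun x => f x * h x) =
      cons_fun (fun x => f x * h x) rest.
    by rewrite [in LHS](cons_fun_eta rho) cons_fun_dfwith0.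
  rewrite -(boundaryE cT _ cfh); last first.
    split; first exact: hoelder_cM.
    by move=> j; apply: bounded_lip_loc1; exact: brho.
  (* This is [T(f, h, rest) = dT(f h, rest) - T(s h, f, rest)]. The boundary term costs [M' S d]; in
     the other one [f] has become an argument and costs its Lipschitz constant, giving [M d A]. *)
  move=> /eqP; rewrite -subr_eq => /eqP <-.
  rewrite (le_trans (ler_normB _ _))// addrC mulrDl lerD//.
    have := @mass_bounded1 _ _ _ T V M (fun x => s x * h x)
      (dfwith rho ord0 f) d (dfwith P ord0 A) TM d0.
    have -> : \prod_j dfwith P ord0 A j = A * \prod_(j | j != ord0) P j.
      rewrite (bigD1 ord0)//= dfwithin; congr (_ * _); apply: eq_bigr => j j0.
      by rewrite dfwithE eq_sym (negbTE j0).
    rewrite -mulrA [A * (d * _)]mulrCA; apply.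
    - by move=> j; rewrite dfwithE; case: eqP.
    - exact: hoelder_cM.
    - by apply: subset_trans sV; exact: sptMl.
    - move=> x; rewrite normrM -[leRHS]mul1r ler_pM//; exact: plateau_norm bs.
    - by move=> j; rewrite !dfwithE; case: eqP.
  have := @mass_bounded1 _ _ _ (boundary T) V M' (fun x => f x * h x)
      rest (S * d) (fun j => P (lift ord0 j)) TM'.
  rewrite prod0 -!mulrA; apply => //.
  - by rewrite mulr_gt0.
  - exact: hoelder_cM.
  - by apply: subset_trans fV; exact: sptMl.
  - by move=> x; rewrite normrM ler_pM.
case: (unliftP ord0 i) => [k|] ->; last exact: main.
(* For a later slot, [h] trades places with [pi ord0]; the constant [L ord0] moves along, so the
   product of the remaining constants is unchanged. *)
rewrite -[in dfwith pi _ _](dfwith_id pi ord0) functional_swap// normrN.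
have ne := neq_lift ord0 k.
rewrite (dfwithC _ _ _ ne).
have -> : \prod_(j | j != lift ord0 k) L j =
    \prod_(j | j != ord0) dfwith L (lift ord0 k) (L ord0) j.
  rewrite (bigD1 ord0)//= [RHS](bigD1 (lift ord0 k))//= dfwithin; congr (_ * _).
  apply: eq_big => [j|j /andP[j0 _]]; first exact: andbC.
  by rewrite dfwithE eq_sym (negbTE j0).
by apply: main => j; rewrite !dfwithE; case: eqP.
Qed.

End boundary.

(** * Comparing approximations at a given scale *)

Lemma prod_powR (R : realType) (I : Type) (s : seq I) (e : R) (F : I -> R) :
  0 < e -> \prod_(i <- s) e `^ F i = e `^ (\sum_(i <- s) F i).
Proof.
move=> e0; elim: s => [|i s IHs]; first by rewrite !big_nil powRr0.
by rewrite !big_cons IHs powRD// (gt_eqF e0) implybT.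
Qed.

Section comparison.
Context {R : realType} {X : metricType R}.
Implicit Types (f g h p q : X -> R) (K U V : set X).

Definition approx_fun K H e c f g :=
  [/\ spt g `<=` K, forall x, `|g x| <= H,
    hoelder_bound (H * e `^ (c - 1)) 1 setT g &
    forall x, `|g x - f x| <= H * e `^ c].

(** Closeness is asked on [U] only, as [p] is not controlled far away and locality ignores what
    happens there. Unlike in [approx_fun], the sup bound is qualitative: only the Lipschitz constant
    of an argument enters the estimates. *)
Definition approx_arg U H e c p q :=
  [/\ bounded_lip q, hoelder_bound (H * e `^ (c - 1)) 1 setT q &
    forall x, U x -> `|q x - p x| <= H * e `^ c].

Lemma normal_parts_bound n (T : functional X n) K :
  locally_compact [set: X] -> locally_normal T -> compact K ->
  exists V M M', [/\ K `<=` V, mass_bounded T V M, 0 <= M' &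
    forall f (pi : 'I_n -> X -> R) (L : 'I_n -> R) A S d i h,
    hoelder_c 1 f -> spt f `<=` V -> (forall j, bounded_lip (pi j)) ->
    bounded_lip h -> 0 < A -> 0 < S -> 0 < d -> (forall j, 0 < L j) ->
    hoelder_bound A 1 setT f -> (forall x, `|f x| <= S) ->
    (forall x, `|h x| <= d) -> (forall j, hoelder_bound (L j) 1 setT (pi j)) ->
    `|T f (dfwith pi i h)| <= (M * A + M' * S) * (d * \prod_(j | j != i) L j)].
Proof.
move=> lcX [cT nT] cK.
have [chi [W [bchi oW KW chi1]]] := exists_plateau lcX cK openT (@subsetT _ K).
have cchi : compact (spt chi) by case: bchi.
(* An open neighbourhood of [K] with compact closure, as [locally_normal] requires for finite
   mass. *)
set V := interior (spt chi); have oV : open V by exact: open_interior.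
have KV : K `<=` V.
  by apply: subset_trans KW _; exact: plateau_interior oW chi1.
have cV : compact (closure V).
  apply: subclosed_compact cchi _; first exact: closed_closure.
  rewrite [X in _ `<=` X](closure_id _).1; last exact: closed_closure.
  by apply: closureS; exact: interior_subset.
have [Tlin Tloc _] := cT.
case: n T cT Tlin Tloc nT => [|n] T cT Tlin Tloc /(_ V oV cV)/= nT.
  have [M TM] := mass_fin_bounded Tlin Tloc nT.
  (* In dimension [0] there is no slot [i], so the bound by parts is vacuous. *)
  by exists V, M, 0; split => // f pi L A S d [].
have mass_ge0 m (S : functional X m) : (0 <= mass S V)%E.
  by apply: le_ereal_inf_tmp => y [].
have [M TM] : exists M, mass_bounded T V M.
  apply: mass_fin_bounded => //; apply: le_lt_trans nT.
  by rewrite leeDl.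
have [M' TM'] : exists M', mass_bounded (boundary T) V M'.
  apply: mass_fin_bounded; [exact: boundary_multilinear|exact: boundary_local|].
  by apply: le_lt_trans nT; rewrite leeDr.
exists V, M, M'; split => //; first by case: TM'.
by move=> *; exact: (functional_parts lcX cT oV TM TM').
Qed.

Context {n : nat}.
Variables (a : R) (b : 'I_n -> R) (T : functional X n).
Hypotheses (lcX : locally_compact [set: X]) (a01 : 0 < a <= 1)
  (b01 : forall i, 0 < b i <= 1) (nT : locally_normal T).
Implicit Types (pi rho : 'I_n -> X -> R).

Definition approximates K U H e f pi g rho :=
  approx_fun K H e a f g /\
  forall i, approx_arg U H e (b i) (pi i) (rho i).

Definition excess := a + \sum_i b i - n%:R.

Lemma approx_dom K U H e f pi g rho : compact K ->
  approximates K U H e f pi g rho -> hoelder_dom 1 (fun=> 1) g rho.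
Proof.
move=> cK [[gK gH gL _] rhoP]; split.
  apply/hoelder_c_lip; split; last exact: compact_spt gK.
  exact: bounded_lipW gH gL.
by move=> i; have [brho _ _] := rhoP i; exact: bounded_lip_loc1.
Qed.

(** Replacing [g] costs [e^a] in sup norm times all the [e^(b_i - 1)], by the mass bound. Replacing
    [rho i] costs [e^(a - 1)] times [e^(b_i)] times the other [e^(b_j - 1)], by integration by
    parts. Both exponents equal [excess]. *)
Lemma approx_compare K H : compact K -> 0 < H -> exists C, 0 <= C /\
  forall U e f pi g rho g' rho', open U -> K `<=` U -> 0 < e <= 1 ->
  approximates K U H e f pi g rho -> approximates K U H e f pi g' rho' ->
  `|T g rho - T g' rho'| <= C * e `^ excess.
Proof.
move=> cK H0; have [V [M [M' [KV TM M'0 parts]]]] := normal_parts_bound lcX nT cK.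
have M0 : 0 <= M by case: TM.
have [[Tlin Tloc _] _] := nT.
exists ((M + (M + M') *+ n) * H ^+ n.+1 *+ 2); split.
  rewrite mulrn_wge0// mulr_ge0 ?exprn_ge0 ?(ltW H0)//.
  by rewrite addr_ge0// mulrn_wge0// addr_ge0.
move=> U e f pi g rho g' rho' oU KU /andP[e0 e1] ag ag'.
have := approx_dom cK ag; have := approx_dom cK ag'.
move: ag ag' => [[gK gH gL gf] rhoP] [[g'K g'H g'L g'f] rhoP'].
move=> [hg' hrho'] [hg hrho].
have He c : 0 < H * e `^ c by rewrite mulr_gt0// powR_gt0.
pose w := \prod_(i < n) (H * e `^ (b i - 1)).
have w0 : 0 < w by exact: prodr_gt0.
have wE : w = H ^+ n * e `^ (excess - a).
  rewrite /w big_split/= prodr_const card_ord prod_powR//; congr (_ * _ `^ _).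
  by rewrite sumrB sumr_const card_ord /excess; ring.
have B1 : `|T (fun x => g x - g' x) rho| <= M * (H * e `^ a *+ 2 * w).
  have hgg' : hoelder_c 1 (fun x => g x - g' x).
    have -> : (fun x => g x - g' x) = (fun x => -1 * g' x + g x).
      by apply/funext => x; rewrite mulN1r addrC.
    exact: hoelder_c_lin.
  apply: (mass_bounded1 TM) => //.
  - by rewrite pmulrn_rgt0.
  - apply: subset_trans KV; apply: spt_subset; first exact: closed_compact.
    by move=> x Kx; rewrite !spt_notin ?subrr// => [/g'K|/gK].
  - move=> x; have := gf x; have := g'f x; rewrite !ler_norml => /andP[? ?].
    by move=> /andP[? ?]; rewrite mulr2n; apply/andP; split; lra.
  - by move=> i; have [_ ? _] := rhoP i.
have B2 : `|T g' rho - T g' rho'| <=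
    \sum_(i < n) (M * (H * e `^ (a - 1)) + M' * H) * (e * w *+ 2).
  rewrite (functional_telescope Tlin)//.
  rewrite (le_trans (ler_norm_sum _ _ _))// ler_sum// => i _.
  set hyb := hybrid i rho' rho; pose h x := rho i x - rho' i x.
  have bhyb j : bounded_lip (hyb j).
    by have [? _ _] := rhoP j; have [? _ _] := rhoP' j; rewrite /hyb /hybrid; case: ifP.
  have hybL j : hoelder_bound (H * e `^ (b j - 1)) 1 setT (hyb j).
    by have [_ ? _] := rhoP j; have [_ ? _] := rhoP' j; rewrite /hyb /hybrid; case: ifP.
  have bh : bounded_lip h.
    have -> : h = (fun x => -1 * rho' i x + rho i x).
      by apply/funext => x; rewrite /h mulN1r addrC.
    by have [? _ _] := rhoP i; have [? _ _] := rhoP' i; exact: bounded_lip_lin.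
  (* Both [rho i] and [rho' i] are within [H e^(b_i)] of [pi i], but only on [U]; hence the
     truncation that follows. *)
  pose d := H * e `^ b i *+ 2; have d0 : 0 < d by rewrite pmulrn_rgt0.
  have bh' : bounded_lip (fun x => clamp d (h x)).
    by have [C [_ _ hC]] := bh; apply: bounded_lip_clamp (ltW d0) _; exists C.
  have hhyb : hoelder_loc_fam (fun=> 1) hyb by move=> j; exact: bounded_lip_loc1.
  have -> : T g' (dfwith hyb i h) = T g' (dfwith hyb i (fun x => clamp d (h x))).
    apply: (functional_local Tlin Tloc) oU _ _.
    - by split => //; apply: hoelder_loc_dfwith => //; exact: bounded_lip_loc1.
    - by apply: hoelder_loc_dfwith => //; exact: bounded_lip_loc1.
    - exact: subset_trans KU.
    - move=> j x Ux; rewrite !dfwithE; case: eqP => // _; rewrite clamp_id//.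
      have [_ _ /(_ x Ux)] := rhoP i; have [_ _ /(_ x Ux)] := rhoP' i.
      rewrite !ler_norml => /andP[? ?] /andP[? ?].
      by rewrite /h /d mulr2n; apply/andP; split; lra.
  apply: le_trans (parts g' hyb (fun j => H * e `^ (b j - 1))
    (H * e `^ (a - 1)) H d i _ _ _ _ _ _ _ _ _ _ _ _ _) _ => //.
  - exact: subset_trans KV.
  - by move=> x; exact/clamp_le/ltW.
  - rewrite le_eqVlt; apply/orP; left; apply/eqP; congr (_ * _).
    rewrite /d /w [in RHS](bigD1 i)//=.
    rewrite -[e `^ b i](@mulr_powRB1 _ e (b i)) ?(ltW e0)//.
      by ring.
    by have /andP[] := b01 i.
have -> : T g rho - T g' rho' =
    T (fun x => g x - g' x) rho + (T g' rho - T g' rho').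
  by rewrite (functionalB Tlin)// addrA subrK.
rewrite (le_trans (ler_normD _ _))// (le_trans (lerD B1 B2))//.
rewrite sumr_const card_ord.
have a1 : e * e `^ (a - 1) = e `^ a.
  by rewrite mulr_powRB1 ?(ltW e0)//; case/andP: a01.
(* This absorbs the sup-norm term of the bound by parts, which comes without the factor
   [e^(a - 1)]. *)
have ea : e <= e `^ a by rewrite ger1_powR ?e0//; case/andP: a01.
have -> : e `^ excess = e `^ a * e `^ (excess - a).
  by rewrite -powRD ?subrKC// (gt_eqF e0) implybT.
have -> : (M + (M + M') *+ n) * H ^+ n.+1 *+ 2 * (e `^ a * e `^ (excess - a)) =
    M * (H * e `^ a *+ 2 * w) + ((M * H + M' * H) * (e `^ a * w *+ 2)) *+ n.
  by rewrite wE exprS; ring.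
rewrite lerD2l lerMn2r; apply/orP; right.
rewrite !mulrnAr lerMn2r/= !mulrDl lerD//.
  by rewrite -a1 le_eqVlt; apply/orP; left; apply/eqP; ring.
by rewrite ler_wpM2l ?mulr_ge0 ?(ltW H0)// ler_wpM2r// ltW.
Qed.

End comparison.

(** * Smoothing Hölder functions *)

Section smoothing.
Context {R : realType} {X : metricType R}.
Implicit Types (f g p : X -> R) (A K U W : set X) (a d e s H : R).

(** Bounds the Hölder modulus by a line: for [d <= e] the constant term suffices, and for [d > e]
    the linear one, since [d^(a-1) <= e^(a-1)]. Multiplied by [H], its slope is that of the
    inf-convolution and its constant the approximation error. *)
Lemma powR_interpolation a d e : 0 < a <= 1 -> 0 < e -> 0 <= d ->
  d `^ a <= e `^ (a - 1) * d + e `^ a.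
Proof.
move=> /andP[a0 a1] e0 d0; have [de|ed] := leP d e.
  rewrite (@le_trans _ _ (e `^ a))//.
    by rewrite ge0_ler_powR ?nnegrE// ltW.
  by rewrite lerDr mulr_ge0// powR_ge0.
rewrite (@le_trans _ _ (e `^ (a - 1) * d))//; last by rewrite lerDl powR_ge0.
rewrite -(mulr_powRB1 d0 a0) mulrC ler_wpM2r//.
rewrite -[e `^ (a - 1)]invrK -powRN -[d `^ _]invrK -[in leLHS]powRN.
rewrite lef_pV2 ?posrE ?powR_gt0//; last exact: lt_trans ed.
by rewrite ge0_ler_powR ?nnegrE ?(ltW e0)// ?(ltW ed)//; lra.
Qed.

(* With slope [s = H e^(a-1)] this regularizes a function of [a]-Hölder constant
   [H] at scale [e]; for a nonnegative function it does not enlarge the support,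
   which is why positive and negative parts are smoothed separately. *)
Definition inf_conv s f x := inf [set f y + s * mdist x y | y in setT].

Section inf_conv.
Variables (s : R) (f : X -> R).
Hypotheses (s0 : 0 < s) (f0 : forall x, 0 <= f x).

Let lbf x : lbound [set f y + s * mdist x y | y in setT] 0.
Proof. by move=> _ [y _ <-]; rewrite addr_ge0// mulr_ge0 ?(ltW s0)// mdist_ge0. Qed.

Lemma inf_conv_le x y : inf_conv s f x <= f y + s * mdist x y.
Proof. by apply: ge_inf; [exists 0; exact: lbf|exists y]. Qed.

Lemma inf_conv_ge x c : (forall y, c <= f y + s * mdist x y) ->
  c <= inf_conv s f x.
Proof.
move=> cf; apply: lb_le_inf; first by exists (f x + s * mdist x x), x.
by move=> _ [y _ <-].
Qed.

Lemma inf_conv_ge0 x : 0 <= inf_conv s f x.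
Proof.
by apply: inf_conv_ge => y; rewrite addr_ge0// mulr_ge0 ?(ltW s0)// mdist_ge0.
Qed.

Lemma inf_conv_le_fun x : inf_conv s f x <= f x.
Proof. by rewrite (le_trans (inf_conv_le x x))// mdistxx mulr0 addr0. Qed.

Lemma inf_conv_lip : hoelder_bound s 1 setT (inf_conv s f).
Proof.
apply/lip_boundP => x y _ _.
have main x' y' : inf_conv s f x' - s * mdist x' y' <= inf_conv s f y'.
  apply: inf_conv_ge => z; rewrite lerBlDr (le_trans (inf_conv_le x' z))//.
  rewrite -addrA lerD2l -mulrDr ler_pM2l// addrC.
  exact: metric_triangle.
have := main x y; have := main y x; rewrite (metric_sym y x) => h1 h2.
by rewrite ler_norml; apply/andP; split; lra.
Qed.

End inf_conv.

Lemma inf_conv_close f a e H : 0 < a <= 1 -> 0 < e -> 0 < H ->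
  hoelder_bound H a setT f ->
  forall x, f x - H * e `^ a <= inf_conv (H * e `^ (a - 1)) f x.
Proof.
move=> a01 e0 H0 fH x; apply: inf_conv_ge => y; have := fH x y I I.
rewrite ler_norml => /andP[_ h].
have := ler_wpM2l (ltW H0) (powR_interpolation a01 e0 (mdist_ge0 x y)).
by rewrite mulrDr mulrA; lra.
Qed.

(** The last clause, a Hölder bound independent of [e], is what later makes smoothed functions
    converge in the sense of the continuity axiom. Within distance [e] it follows from the Lipschitz
    constant [2 s]; beyond [e], two errors [H e^a] add to the modulus of [f]. *)
Lemma exists_smoothing f a e H : 0 < a <= 1 -> 0 < e -> 0 < H ->
  (forall x, `|f x| <= H) -> hoelder_bound H a setT f ->
  exists g, [/\ spt g `<=` spt f, forall x, `|g x| <= H,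
    hoelder_bound (3 * H * e `^ (a - 1)) 1 setT g,
    forall x, `|g x - f x| <= H * e `^ a & hoelder_bound (3 * H) a setT g].
Proof.
move=> a01 e0 H0 fH fa; set s := H * e `^ (a - 1).
have s0 : 0 < s by rewrite mulr_gt0// powR_gt0.
pose fp x := Num.max 0 (f x); pose fm x := Num.max 0 (- f x).
have fp0 x : 0 <= fp x by rewrite le_max lexx.
have fm0 x : 0 <= fm x by rewrite le_max lexx.
have fpa : hoelder_bound H a setT fp.
  rewrite -[H]mul1r; apply: hoelder_bound_comp fa => // u v.
  by rewrite mul1r maxr_lip.
have fma : hoelder_bound H a setT fm.
  rewrite -[H]mul1r; apply: (@hoelder_bound_comp _ _ (fun u => Num.max 0 (- u))) fa => // u v.
  by rewrite mul1r (le_trans (maxr_lip _ _ _))// -opprD normrN.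
have fE x : f x = fp x - fm x.
  by rewrite /fp /fm; case: leP => ?; case: leP => ?; lra.
have fpm x : fp x <= H /\ fm x <= H.
  have := fH x; rewrite ler_norml => /andP[h1 h2].
  by rewrite /fp /fm !ge_max (ltW H0)/= h2 lerNl h1.
pose gp := inf_conv s fp; pose gm := inf_conv s fm.
have gp0 x : 0 <= gp x by exact: inf_conv_ge0.
have gm0 x : 0 <= gm x by exact: inf_conv_ge0.
have gpf x : gp x <= fp x by exact: inf_conv_le_fun.
have gmf x : gm x <= fm x by exact: inf_conv_le_fun.
have gpc := inf_conv_close a01 e0 H0 fpa; rewrite -/s -/gp in gpc.
have gmc := inf_conv_close a01 e0 H0 fma; rewrite -/s -/gm in gmc.
have gL : hoelder_bound (2 * s) 1 setT (fun x => gp x - gm x).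
  have -> : (fun x => gp x - gm x) = (fun x => -1 * gm x + gp x).
    by apply/funext => x; rewrite mulN1r addrC.
  have -> : 2 * s = `|-1| * s + s by rewrite normrN1; ring.
  exact: hoelder_bound_lin (inf_conv_lip s0 fm0) (inf_conv_lip s0 fp0).
(* Both parts are approximated from below, so their errors enter with opposite signs and do not add
   up. *)
have gf x : `|gp x - gm x - f x| <= H * e `^ a.
  rewrite fE ler_norml; have := gpf x; have := gmf x; have := gpc x.
  by have := gmc x => ? ? ? ?; apply/andP; split; lra.
exists (fun x => gp x - gm x); split => //.
- apply: spt_le => x fx0; have := gpf x; have := gmf x; have := gp0 x.
  by have := gm0 x; rewrite /fp /fm fx0 oppr0 maxxx => *; lra.
- move=> x; have [? ?] := fpm x; have := gpf x; have := gmf x; have := gp0 x.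
  by have := gm0 x; rewrite ler_norml => *; apply/andP; split; lra.
- apply: hoelder_bound_le gL; rewrite -mulrA -/s ler_pM2r//.
  by rewrite ler_nat.
- move=> x y _ _; have d0 := mdist_ge0 x y.
  have [de|ed] := leP (mdist x y) e.
    have /lip_boundP/(_ x y I I) := gL => /le_trans; apply.
    move: d0; rewrite le_eqVlt => /predU1P[<-|d0].
      by rewrite mulr0 !mulr_ge0 ?powR_ge0// ltW.
    rewrite /s -!mulrA; apply: ler_pM => //; [|by rewrite ler_nat|].
      by rewrite !mulr_ge0 ?powR_ge0// ltW.
    rewrite ler_pM2l//; have /andP[a0 a1] := a01.
    rewrite -(mulr_powRB1 (ltW d0) a0) mulrC ler_pM2l//.
    rewrite -[e `^ (a - 1)]invrK -powRN -[mdist x y `^ _]invrK -[in leRHS]powRN.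
    rewrite lef_pV2 ?posrE ?powR_gt0//.
    by rewrite ge0_ler_powR ?nnegrE ?(ltW e0)// ?(ltW d0)//; lra.
  have ea : e `^ a <= mdist x y `^ a.
    by have /andP[a0 _] := a01; rewrite ge0_ler_powR ?nnegrE// ltW.
  have := ler_wpM2l (ltW H0) ea; have := fa x y I I.
  have := gf x; have := gf y; rewrite !ler_norml => /andP[? ?] /andP[? ?].
  by move=> /andP[? ?] ?; apply/andP; split; lra.
Qed.

(** The product turns control on [spt chi] into global control. Between a point inside and one
    outside the support only the variation of [chi] counts, since [chi] vanishes outside. [D]
    depends on [chi] alone and serves all exponents. *)
Lemma plateau_hoelderM U (chi : X -> R) : plateau U chi ->
  exists D, 1 <= D /\ forall a H p, 0 < a <= 1 -> 0 < H ->
    (forall x, spt chi x -> `|p x| <= H) -> hoelder_bound H a (spt chi) p ->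
    (forall x, `|chi x * p x| <= H) /\
    hoelder_bound (D * H) a setT (fun x => chi x * p x).
Proof.
move=> bchi; have [_ [C [C0 chiC chiL]] _ _] := bchi.
exists (1 + (C *+ 2 + C)); split.
  by rewrite lerDl addr_ge0 ?mulrn_wge0// ltW.
move=> a H p a01 H0 pH pa; have c1 x := plateau_norm x bchi; split => [x|x y _ _].
  have [/pH px|/spt_notin ->] := pselect (spt chi x); last first.
    by rewrite mul0r normr0 ltW.
  by rewrite normrM -[leRHS]mul1r ler_pM.
have chia := lip_hoelder a01 (ltW C0) (fun x (_ : setT x) => chiC x) chiL.
set D := C *+ 2 + C in chia *; have D0 : 0 <= D.
  by rewrite addr_ge0 ?mulrn_wge0// ltW.
have out u v : spt chi u -> ~ spt chi v ->
    `|chi u * p u - chi v * p v| <= (1 + D) * H * mdist u v `^ a.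
  move=> cu cv; have := chia u v I I; rewrite (spt_notin cv) mul0r !subr0 => cuv.
  rewrite normrM mulrC -mulrA mulrDl mul1r.
  rewrite (le_trans (ler_pM _ _ (pH _ cu) cuv))// mulrCA lerDr.
  by rewrite mulr_ge0 ?powR_ge0// ltW.
have [cx|cx] := pselect (spt chi x); have [cy|cy] := pselect (spt chi y).
- have -> : (1 + D) * H = 1 * H + H * D by ring.
  exact: (hoelder_boundM (fun x _ => c1 x) pH
    (hoelder_bound_sub (@subsetT _ _) chia) pa).
- exact: out.
- by rewrite distrC metric_sym; exact: out.
- rewrite (spt_notin cx) (spt_notin cy) !mul0r subrr normr0 !mulr_ge0 ?powR_ge0 ?(ltW H0)//.
  by rewrite addr_ge0.
Qed.

End smoothing.

(** With [D = C / (1 - q)], subtracting or adding the tail [D q^k] makes the sequence monotone; the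
    limit is squeezed between the two results, which also gives the rate. *)
Lemma geometric_cauchy (R : realType) (t : nat -> R) C q : 0 < q < 1 ->
  (forall k, `|t k.+1 - t k| <= C * q ^+ k) ->
  exists y, t @ \oo --> y /\ forall k, `|t k - y| <= C / (1 - q) * q ^+ k.
Proof.
move=> /andP[q0 q1] tC; have q1' : 0 < 1 - q by rewrite subr_gt0.
have C0 : 0 <= C by have := tC 0%N; rewrite expr0 mulr1; exact: le_trans.
set D := C / (1 - q); have D0 : 0 <= D by rewrite divr_ge0// ltW.
have DC k : D * q ^+ k - D * q ^+ k.+1 = C * q ^+ k.
  by rewrite -mulrBr exprS -[X in X - _]mul1r -mulrBl mulrA /D divfK// gt_eqF.
pose u k := t k - D * q ^+ k; pose v k := t k + D * q ^+ k.
have qlim : (fun k => D * q ^+ k) @ \oo --> 0.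
  by apply: cvg_geometric; rewrite ger0_norm// ltW.
have und : nondecreasing_seq u.
  apply/nondecreasing_seqP => k; have := tC k; rewrite -DC ler_norml /u.
  by move=> /andP[? ?]; lra.
have vni : nonincreasing_seq v.
  apply/nonincreasing_seqP => k; have := tC k; rewrite -DC ler_norml /v.
  by move=> /andP[? ?]; lra.
have uv k : u k <= v k.
  by rewrite lerD2l -subr_ge0 opprK addr_ge0// mulr_ge0// exprn_ge0// ltW.
have ucvg : cvgn u.
  apply: nondecreasing_is_cvgn => //; exists (v 0%N) => _ [k _ <-].
  by rewrite (le_trans (uv k))// vni.
set y := limn u; have uy : u @ \oo --> y by [].
have ty : t @ \oo --> y.
  have -> : t = (fun k => u k + D * q ^+ k).
    by apply/funext => k; rewrite /u subrK.
  by rewrite -[y]addr0; exact: cvgD uy qlim.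
have vy : v @ \oo --> y by rewrite -[y]addr0; exact: cvgD ty qlim.
exists y; split => // k.
have h1 : u k <= y by apply: nondecreasing_cvgn_le.
have h2 : y <= v k.
  rewrite -(cvg_lim _ vy)//; apply: nonincreasing_cvgn_ge => //.
  by apply/cvg_ex; exists y.
by move: h1 h2; rewrite /u /v ler_norml => *; apply/andP; split; lra.
Qed.

(** * The extension *)

Lemma cvg_geometric_bound (R : realType) (u : nat -> R) y C q : 0 < q < 1 ->
  (forall k, `|u k - y| <= C * q ^+ k) -> u @ \oo --> y.
Proof.
move=> /andP[q0 q1] uC.
have qlim : (fun k => C * q ^+ k) @ \oo --> 0.
  by apply: cvg_geometric; rewrite ger0_norm// ltW.
apply: (@squeeze_cvgr _ _ _ _ (fun k => y - C * q ^+ k)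
  (fun k => y + C * q ^+ k)).
- near=> k; have := uC k; rewrite ler_norml => /andP[? ?].
  by apply/andP; split; lra.
- by rewrite -[X in _ --> X](subr0 y); exact: cvgB (cvg_cst _) qlim.
- by rewrite -[X in _ --> X](addr0 y); exact: cvgD (cvg_cst _) qlim.
Unshelve. all: by end_near.
Qed.

Lemma geometric_bound_eq (R : realType) (x y C q : R) : 0 < q < 1 ->
  (forall k, `|x - y| <= C * q ^+ k) -> x = y.
Proof.
move=> q01 xy; have /cvg_lim <- // := cvg_geometric_bound (u := fun=> x) q01 xy.
by rewrite lim_cst.
Qed.

Section approximation.
Context {R : realType} {X : metricType R}.
Implicit Types (f g p r : X -> R) (K A U W : set X) (c e H D : R).

Lemma approx_fun_le K K' H H' e c f g : K `<=` K' -> H <= H' ->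
  approx_fun K H e c f g -> approx_fun K' H' e c f g.
Proof.
move=> KK HH [gK gH gL gf]; split.
- exact: subset_trans KK.
- by move=> x; rewrite (le_trans (gH x)).
- by apply: hoelder_bound_le gL; rewrite ler_wpM2r ?powR_ge0.
- by move=> x; rewrite (le_trans (gf x))// ler_wpM2r ?powR_ge0.
Qed.

Lemma approx_arg_le U U' H H' e c p r : U' `<=` U -> H <= H' ->
  approx_arg U H e c p r -> approx_arg U' H' e c p r.
Proof.
move=> UU HH [br rL rp]; split => //.
- by apply: hoelder_bound_le rL; rewrite ler_wpM2r ?powR_ge0.
- by move=> x /UU Ux; rewrite (le_trans (rp x Ux))// ler_wpM2r ?powR_ge0.
Qed.

Lemma powR_half c e : 0 < c <= 1 -> 0 < e -> (e / 2) `^ c <= 2 * e `^ c.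
Proof.
move=> /andP[c0 c1] e0; rewrite (@le_trans _ _ (e `^ c))//.
  rewrite ge0_ler_powR ?nnegrE ?(ltW c0) ?(ltW e0)//.
    by rewrite divr_ge0// ltW.
  by rewrite ler_pdivrMr// ler_peMr ?(ltW e0)// ler1n.
by rewrite ler_peMl ?powR_ge0// ler1n.
Qed.

Lemma powR_half1 c e : 0 < c <= 1 -> 0 < e ->
  (e / 2) `^ (c - 1) <= 2 * e `^ (c - 1).
Proof.
move=> /andP[c0 c1] e0; have e20 : 0 < e / 2 by rewrite divr_gt0.
rewrite -(ler_pM2l e20) mulr_powRB1 ?(ltW e20)//.
rewrite mulrA divfK ?pnatr_eq0// mulr_powRB1 ?(ltW e0)//.
rewrite ge0_ler_powR ?nnegrE ?(ltW c0) ?(ltW e0) ?(ltW e20)//.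
by rewrite ler_pdivrMr// ler_peMr ?(ltW e0)// ler1n.
Qed.

(** Lets consecutive dyadic scales be compared at the coarser one. The factor [2] covers the loss
    [2^(1-c)] in the Lipschitz constant. *)
Lemma approx_fun_half K H e c f g : 0 < c <= 1 -> 0 < e -> 0 < H ->
  approx_fun K H (e / 2) c f g -> approx_fun K (2 * H) e c f g.
Proof.
move=> c01 e0 H0 [gK gH gL gf]; split => //.
- by move=> x; rewrite (le_trans (gH x))// ler_peMl ?(ltW H0)// ler1n.
- apply: hoelder_bound_le gL; rewrite [2 * H]mulrC -mulrA ler_pM2l//.
  exact: powR_half1.
- move=> x; rewrite (le_trans (gf x))// [2 * H]mulrC -mulrA ler_pM2l//.
  exact: powR_half.
Qed.

Lemma approx_arg_half U H e c p r : 0 < c <= 1 -> 0 < e -> 0 < H ->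
  approx_arg U H (e / 2) c p r -> approx_arg U (2 * H) e c p r.
Proof.
move=> c01 e0 H0 [br rL rp]; split => //.
- apply: hoelder_bound_le rL; rewrite [2 * H]mulrC -mulrA ler_pM2l//.
  exact: powR_half1.
- move=> x Ux; rewrite (le_trans (rp x Ux))// [2 * H]mulrC -mulrA ler_pM2l//.
  exact: powR_half.
Qed.

Definition tame_arg A H c p :=
  (forall x, A x -> `|p x| <= H) /\ hoelder_bound H c A p.

Lemma tame_arg_le A H H' c p : H <= H' -> tame_arg A H c p -> tame_arg A H' c p.
Proof.
move=> HH [pH pc]; split; last exact: hoelder_bound_le pc.
by move=> x /pH px; rewrite (le_trans px).
Qed.

Definition frame K U chi W := [/\ plateau U chi, open W, K `<=` W &
  forall x, W x -> chi x = 1].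

Lemma exists_approx_fun f c e H : 0 < c <= 1 -> 0 < e -> 0 < H ->
  tame_arg setT H c f -> exists g,
  approx_fun (spt f) (3 * H) e c f g /\ hoelder_bound (3 * H) c setT g.
Proof.
move=> c01 e0 H0 [fH fc].
have [g [gf gH gL gfe gc]] := exists_smoothing c01 e0 H0 (fun x => fH x I) fc.
have H3 : H <= 3 * H by rewrite ler_peMl ?(ltW H0)// ler1n.
exists g; split => //; split => // x; first by rewrite (le_trans (gH x)).
by rewrite (le_trans (gfe x))// ler_wpM2r ?powR_ge0.
Qed.

(** The argument is cut off before it is smoothed. The two global clauses, closeness to [chi p] and
    the Hölder bound, serve the uniqueness proof. *)
Lemma exists_approx_arg K U chi W : frame K U chi W ->
  exists D, 1 <= D /\ forall c e H p, 0 < c <= 1 -> 0 < e -> 0 < H ->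
  tame_arg (spt chi) H c p -> exists r, [/\ approx_arg W (D * H) e c p r,
    forall x, `|r x - chi x * p x| <= D * H * e `^ c &
    hoelder_bound (D * H) c setT r].
Proof.
move=> [bchi oW KW chi1]; have [D [D1 HD]] := plateau_hoelderM bchi.
have D0 : 0 < D by rewrite (lt_le_trans ltr01).
exists (3 * D); split; first by rewrite mulr_ege1// ler1n.
move=> c e H p c01 e0 H0 [pH pc]; have [cpH cpc] := HD c H p c01 H0 pH pc.
have DH0 : 0 < D * H by rewrite mulr_gt0.
have HDH : H <= D * H by rewrite ler_peMl ?(ltW H0).
have cpDH x : `|chi x * p x| <= D * H by rewrite (le_trans (cpH x)).
have [r [_ rH rL rp rc]] := exists_smoothing c01 e0 DH0 cpDH cpc.
have rp' x : `|r x - chi x * p x| <= 3 * D * H * e `^ c.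
  rewrite (le_trans (rp x))// ler_wpM2r ?powR_ge0// -mulrA.
  by rewrite ler_peMl ?(ltW DH0)// ler1n.
exists r; split => //; last by rewrite -mulrA.
split; [exact: bounded_lipW rH rL|by rewrite -(mulrA 3)|].
by move=> x Wx; have := rp' x; rewrite chi1// mul1r.
Qed.

End approximation.

Section extension.
Context {R : realType} {X : metricType R} {n : nat}.
Variables (a : R) (b : 'I_n -> R) (T : functional X n).
Hypotheses (lcX : locally_compact [set: X]) (a01 : 0 < a <= 1)
  (b01 : forall i, 0 < b i <= 1) (ab : n%:R < a + \sum_i b i)
  (nT : locally_normal T).
Implicit Types (f g p r : X -> R) (pi rho : 'I_n -> X -> R)
  (K A U W : set X) (c e H D C : R).

Definition scale k : R := 2^-1 ^+ k.

Lemma scale_gt0 k : 0 < scale k.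
Proof. by rewrite exprn_gt0// invr_gt0. Qed.

Lemma scale01 k : 0 < scale k <= 1.
Proof.
by rewrite scale_gt0 exprn_ile1 ?invr_ge0 ?invf_le1// ler1n.
Qed.

Lemma scaleS k : scale k.+1 = scale k / 2.
Proof. by rewrite /scale exprSr. Qed.

Definition rate : R := 2^-1 `^ excess a b.

Lemma rate01 : 0 < rate < 1.
Proof.
have g0 : 0 < excess a b by rewrite subr_gt0.
have := @gt0_ltr_powR R _ g0 2^-1 1; rewrite powR1 /rate => h.
by rewrite powR_gt0 ?invr_gt0//= h ?nnegrE ?invr_ge0// invf_lt1// ltr1n.
Qed.

Lemma scale_excess k : scale k `^ excess a b = rate ^+ k.
Proof.
have h : 0 <= 2^-1 :> R by rewrite invr_ge0.
by rewrite /scale -(powR_mulrn _ h) -powRrM mulrC powRrM powR_mulrn ?powR_ge0.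
Qed.

(** Records the only features of a pair on which later constants may depend; this uniformity is what
    gives continuity. *)
Definition tame K A H f pi := [/\ spt f `<=` K, tame_arg setT H a f &
  forall i, tame_arg A H (b i) (pi i)].

Lemma tame_le K A H H' f pi : H <= H' -> tame K A H f pi -> tame K A H' f pi.
Proof.
move=> HH [fK fH piH]; split => //; first exact: tame_arg_le fH.
by move=> i; exact: tame_arg_le (piH i).
Qed.

Lemma exists_tame K A f pi : hoelder_dom a b f pi -> spt f `<=` K ->
  compact A -> exists2 H, 0 < H & tame K A H f pi.
Proof.
move=> [hf hpi] fK cA; have /andP[a0 _] := a01.
have [C [C0 fC fa]] := hoelder_c_bounded a0 hf.
have /choice[L HL] : forall i, exists L, 0 < L /\ tame_arg A L (b i) (pi i).
  move=> i; have /andP[b0 _] := b01 i.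
  by have [L [L0 pL pb]] := hoelder_loc_compact b0 (hpi i) cA; exists L.
have L0 i : 0 <= L i by have [/ltW] := HL i.
exists (C + \sum_i L i); first by rewrite ltr_wpDr// sumr_ge0.
split => //.
  by apply: (@tame_arg_le _ _ _ C); [rewrite lerDl sumr_ge0|split].
move=> i; have [_] := HL i; apply: tame_arg_le.
by rewrite (bigD1 i)//= addrCA lerDl addr_ge0 ?(ltW C0)// sumr_ge0.
Qed.

(* The [g_ k] are supported in [spt f] itself, which makes any two such
   sequences comparable. *)
Definition limit_value f pi (y : R) := exists U H (g_ : nat -> X -> R)
    (rho_ : nat -> 'I_n -> X -> R), [/\ open U, spt f `<=` U,
  0 < H, forall k, approximates a b (spt f) U H (scale k) f pi (g_ k) (rho_ k) &
  T (g_ k) (rho_ k) @[k --> \oo] --> y].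

Lemma approx_le K K' U U' H H' e f pi g rho : K `<=` K' -> U' `<=` U ->
  H <= H' -> approximates a b K U H e f pi g rho ->
  approximates a b K' U' H' e f pi g rho.
Proof.
move=> KK UU HH [gf rhop]; split; first exact: approx_fun_le gf.
by move=> i; exact: approx_arg_le (rhop i).
Qed.

Lemma approx_half K U H e f pi g rho : 0 < e -> 0 < H ->
  approximates a b K U H (e / 2) f pi g rho -> approximates a b K U (2 * H) e f pi g rho.
Proof.
move=> e0 H0 [gf rhop]; split; first exact: approx_fun_half.
by move=> i; exact: approx_arg_half.
Qed.

Lemma limit_value_unique f pi y y' : compact (spt f) ->
  limit_value f pi y -> limit_value f pi y' -> y = y'.
Proof.
move=> cf [U [H [g [rho [oU fU H0 ag gy]]]]].
move=> [U' [H' [g' [rho' [oU' fU' H0' ag' gy']]]]].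
have [C [C0 HC]] := approx_compare lcX a01 b01 nT cf (addr_gt0 H0 H0').
have : (fun k => T (g k) (rho k) - T (g' k) (rho' k)) @ \oo --> 0.
  apply: (@cvg_geometric_bound _ _ _ C rate); first exact: rate01.
  move=> k; rewrite subr0 -scale_excess.
  apply: (HC (U `&` U')) => //; first exact: openI.
  - by move=> x fx; split; [exact: fU|exact: fU'].
  - exact: scale01.
  - by apply: (approx_le _ _ _ (ag k)); [|move=> x []|rewrite lerDl ltW].
  - by apply: (approx_le _ _ _ (ag' k)); [|move=> x []|rewrite lerDr ltW].
have h1 : (fun k => T (g k) (rho k) - T (g' k) (rho' k)) @ \oo --> y - y'.
  exact: cvgB.
move=> h2; apply/eqP; rewrite -subr_eq0; apply/eqP.
by rewrite -(cvg_lim (@Rhausdorff R) h1); exact: cvg_lim h2.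
Qed.

(** The default [0] is never met on [hoelder_dom a b], where smoothing supplies a limit value. *)
Definition extension f pi := xget 0 (limit_value f pi).

Lemma exists_approximates K U chi W : frame K U chi W ->
  exists D, 1 <= D /\ forall H f pi, 0 < H -> tame K (spt chi) H f pi ->
  forall k, exists g rho,
    [/\ approximates a b (spt f) W (D * H) (scale k) f pi g rho,
      hoelder_bound (D * H) a setT g,
      forall i, hoelder_bound (D * H) (b i) setT (rho i) &
      forall i x, `|rho i x - chi x * pi i x| <= D * H * scale k `^ b i].
Proof.
move=> fr; have [D [D1 HD]] := exists_approx_arg fr.
exists (D + 3); split; first by lra.
move=> H f pi H0 [_ fH piH] k.
have HD3 : D * H <= (D + 3) * H by rewrite ler_pM2r//; lra.
have H33 : 3 * H <= (D + 3) * H by rewrite ler_pM2r//; lra.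
have [g [ag ga]] := exists_approx_fun a01 (scale_gt0 k) H0 fH.
have /choice[rho Hrho] : forall i, exists r,
    [/\ approx_arg W ((D + 3) * H) (scale k) (b i) (pi i) r,
      hoelder_bound ((D + 3) * H) (b i) setT r &
      forall x, `|r x - chi x * pi i x| <= (D + 3) * H * scale k `^ b i].
  move=> i; have [r [ar rchi rb]] := HD _ _ _ _ (b01 i) (scale_gt0 k) H0 (piH i).
  exists r; split; [exact: approx_arg_le ar|exact: hoelder_bound_le rb|].
  by move=> x; rewrite (le_trans (rchi x))// ler_wpM2r// powR_ge0.
exists g, rho; split.
- by split=> [|i]; [exact: approx_fun_le ag|case: (Hrho i)].
- exact: hoelder_bound_le ga.
- by move=> i; case: (Hrho i).
- by move=> i; case: (Hrho i).
Qed.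

(** The estimate to which the properties of the extension reduce. [C] depends on the pair only
    through [K], the frame and [H], and [g] need only be supported in [K], so pairs with different
    supports can share one approximation scheme. *)
Lemma extension_approx K U chi W H : compact K -> frame K U chi W -> 0 < H ->
  exists C, 0 <= C /\ forall f pi, tame K (spt chi) H f pi ->
    forall k g rho, approximates a b K W H (scale k) f pi g rho ->
    `|T g rho - extension f pi| <= C * rate ^+ k.
Proof.
move=> cK fr H0; have [D [D1 HD]] := exists_approximates fr.
have [_ oW KW _] := fr; have D0 : 0 < D by rewrite (lt_le_trans ltr01).
pose H1 := D * H; have H10 : 0 < H1 by rewrite mulr_gt0.
have H20 : 0 < 2 * H1 by rewrite mulr_gt0.
have H12 : H1 <= 2 * H1 by rewrite ler_peMl ?(ltW H10)// ler1n.
have HH1 : H <= H1 by rewrite ler_peMl ?(ltW H0).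
have [C [C0 HC]] := approx_compare lcX a01 b01 nT cK H20.
have r01 := rate01; have /andP[r0 r1] := r01.
(* The first [C] compares [(g, rho)] with the reference pair at scale [k]; the second summand is the
   geometric tail from there to the limit. *)
exists (C + C / (1 - rate)); split.
  by rewrite addr_ge0// divr_ge0// subr_ge0 ltW.
move=> f pi fpi k g rho ag; have [fK _ _] := fpi.
have /choice[g_ /choice[rho_ Hk]] := HD H f pi H0 fpi.
have ak j : approximates a b (spt f) W H1 (scale j) f pi (g_ j) (rho_ j).
  by have [] := Hk j.
have ak2 j : approximates a b K W (2 * H1) (scale j) f pi (g_ j) (rho_ j).
  by apply: approx_le (ak j).
have tC j : `|T (g_ j.+1) (rho_ j.+1) - T (g_ j) (rho_ j)| <= C * rate ^+ j.
  rewrite -scale_excess; apply: (HC W) => //; first exact: scale01.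
  apply: approx_half => //; first exact: scale_gt0.
  by rewrite -scaleS; apply: approx_le (ak j.+1).
have [y [ty tyC]] := geometric_cauchy r01 tC.
have fW : spt f `<=` W by exact: subset_trans KW.
have fy : limit_value f pi y by exists W, H1, g_, rho_.
have -> : extension f pi = y.
  apply: limit_value_unique (xgetI 0 fy) fy.
  exact: compact_spt fK.
have := tyC k => h1; rewrite mulrDl.
rewrite (_ : T g rho - y = (T g rho - T (g_ k) (rho_ k)) +
  (T (g_ k) (rho_ k) - y)); last by rewrite addrA subrK.
rewrite (le_trans (ler_normD _ _))// lerD// -scale_excess.
apply: (HC W) => //; first exact: scale01.
by apply: approx_le ag => //; exact: le_trans H12.
Qed.

End extension.

Lemma uniform_cvgP (R : realType) (X : metricType R) (A : set X)
    (f_ : nat -> X -> R) (f : X -> R) : {uniform A, f_ @ \oo --> f} <->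
  forall e, 0 < e -> \forall j \near \oo, forall x, A x -> `|f_ j x - f x| <= e.
Proof.
split=> [fA e e0|fA P /uniform_nbhs[E [entE EP]]].
  have := fA [set h | forall x, A x -> `|h x - f x| <= e]; apply.
  apply/uniform_nbhs; exists [set xy : R * R | `|xy.1 - xy.2| < e]; split.
    by rewrite -entourage_ballE; exists e.
  by move=> h /= H x Ax; rewrite distrC ltW// H.
move: entE; rewrite -entourage_ballE => -[e /= e0 eE].
have e20 : 0 < e / 2 by rewrite divr_gt0.
apply: filterS (fA _ e20) => j H; apply: EP => x Ax; apply: eE => /=.
by rewrite /ball/= distrC (le_lt_trans (H x Ax))// ltr_pdivrMr// ltr_pMr// ltr1n.
Qed.

Lemma scale_small (R : realType) (M c e : R) : 0 < c -> 0 < e ->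
  \forall k \near \oo, M * scale k `^ c <= e.
Proof.
move=> c0 e0; have h : 0 <= 2^-1 :> R by rewrite invr_ge0.
have E k : M * scale k `^ c = M * (2^-1 `^ c) ^+ k.
  congr (M * _); rewrite /scale -(powR_mulrn _ h) -powRrM mulrC powRrM.
  by rewrite powR_mulrn ?powR_ge0.
have : (fun k => M * (2^-1 `^ c) ^+ k) @ \oo --> 0.
  apply: cvg_geometric; rewrite ger0_norm ?powR_ge0//.
  have := @gt0_ltr_powR R _ c0 2^-1 1; rewrite powR1; apply.
  - by rewrite nnegrE.
  - by rewrite nnegrE.
  - by rewrite invf_lt1// ltr1n.
move=> /cvgrPdist_le/(_ e e0); apply: filterS => k.
by rewrite E sub0r normrN => /(le_trans (ler_norm _)).
Qed.

(** * Linearity, locality and agreement on Lipschitz data *)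

Section extension_properties.
Context {R : realType} {X : metricType R} {n : nat}.
Variables (a : R) (b : 'I_n -> R) (T : functional X n).
Hypotheses (lcX : locally_compact [set: X]) (a01 : 0 < a <= 1)
  (b01 : forall i, 0 < b i <= 1) (ab : n%:R < a + \sum_i b i)
  (nT : locally_normal T).
Implicit Types (f g p r : X -> R) (pi rho : 'I_n -> X -> R)
  (K A U W : set X) (c e H D C : R).

Let Tlin : multilinear_on 1 (fun=> 1) T. Proof. by case: nT => -[]. Qed.
Let Tloc : local_on 1 (fun=> 1) T. Proof. by case: nT => -[]. Qed.
Let ext_approx := extension_approx lcX a01 b01 ab nT.
Let ext := extension a b T.

Lemma exists_frame K U : compact K -> open U -> K `<=` U ->
  exists chi W, [/\ frame K U chi W, compact (spt chi) & W `<=` spt chi].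
Proof.
move=> cK oU KU; have [chi [W [bchi oW KW chi1]]] := exists_plateau lcX cK oU KU.
exists chi, W; split => //; first by case: bchi.
by move=> x /chi1 cx; apply: subset_closure => /=; rewrite cx oner_eq0.
Qed.

Lemma approx_fun_lin K H e s f f' g g' : 0 <= H -> compact K ->
  approx_fun K H e a f g -> approx_fun K H e a f' g' ->
  approx_fun K ((`|s| + 1) * H) e a (fun x => s * f x + f' x)
    (fun x => s * g x + g' x).
Proof.
move=> H0 cK [gK gH gL gf] [g'K g'H g'L g'f']; split.
- by apply: subset_trans (@spt_lin _ _ s g g') _ => x [/gK|/g'K].
- move=> x; rewrite mulrDl mul1r (le_trans (ler_normD _ _))// lerD//.
  by rewrite normrM ler_wpM2l.
- by rewrite !mulrDl mul1r -mulrA; exact: hoelder_bound_lin.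
- move=> x; have -> : s * g x + g' x - (s * f x + f' x) =
    s * (g x - f x) + (g' x - f' x) by ring.
  rewrite !mulrDl mul1r -mulrA (le_trans (ler_normD _ _))// lerD//.
  by rewrite normrM ler_wpM2l.
Qed.

Lemma approx_arg_lin U H e c s p p' r r' :
  approx_arg U H e c p r -> approx_arg U H e c p' r' ->
  approx_arg U ((`|s| + 1) * H) e c (fun x => s * p x + p' x)
    (fun x => s * r x + r' x).
Proof.
move=> [br rL rp] [br' rL' rp']; split.
- exact: bounded_lip_lin.
- by rewrite !mulrDl mul1r -mulrA; exact: hoelder_bound_lin.
- move=> x Ux; have -> : s * r x + r' x - (s * p x + p' x) =
    s * (r x - p x) + (r' x - p' x) by ring.
  rewrite !mulrDl mul1r -mulrA (le_trans (ler_normD _ _))// lerD ?rp'//.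
  by rewrite normrM ler_wpM2l// rp.
Qed.

Lemma approx_arg_dfwith U H e pi rho i p r :
  (forall j, approx_arg U H e (b j) (pi j) (rho j)) ->
  approx_arg U H e (b i) p r -> forall j,
  approx_arg U H e (b j) (dfwith pi i p j) (dfwith rho i r j).
Proof. by move=> pr apr j; rewrite !dfwithE; case: eqVneq => // <-. Qed.

Lemma geometric_combination C q s x y z x' y' z' : 0 <= C * q ->
  x' = s * y' + z' -> `|x' - x| <= C * q -> `|y' - y| <= C * q ->
  `|z' - z| <= C * q -> `|x - (s * y + z)| <= (2 + `|s|) * C * q.
Proof.
move=> Cq xyz hx hy hz.
have -> : x - (s * y + z) = - (x' - x) + (s * (y' - y) + (z' - z)).
  by rewrite xyz; ring.
have -> : (2 + `|s|) * C * q = C * q + (`|s| * (C * q) + C * q) by ring.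
rewrite (le_trans (ler_normD _ _))// normrN lerD//.
by rewrite (le_trans (ler_normD _ _))// lerD// normrM ler_wpM2l.
Qed.

(** A combination of approximations approximates the combination at the same scale, with constant
    enlarged by [|s| + 1]. Linearity of [T] thus passes to the extension up to a multiple of
    [rate^k], for every [k]. *)
Lemma extension_multilinear : multilinear_on a b ext.
Proof.
have r0 k : 0 <= rate a b ^+ k.
  by have /andP[/ltW ? _] := rate01 ab; exact: exprn_ge0.
split=> [s f g pi [hf hpi] hg|i s p q f pi [hf hpi] hp hq].
- have cK : compact (spt f `|` spt g) by apply: compactU; [case: hf|case: hg].
  have [chi [W [fr cchi _]]] := exists_frame cK openT (@subsetT _ _).
  have [Hf Hf0 tf] := exists_tame a01 b01 (conj hf hpi)
    (@subsetUl _ (spt f) (spt g)) cchi.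
  have [Hg Hg0 tg] := exists_tame a01 b01 (conj hg hpi)
    (@subsetUr _ (spt f) (spt g)) cchi.
  have [Hl Hl0 tl] := exists_tame a01 b01 (conj (hoelder_c_lin s hf hg) hpi)
    (@spt_lin _ _ s f g) cchi.
  pose H := Hf + Hg + Hl; have H0 : 0 < H by rewrite !addr_gt0.
  have {}tf : tame a b (spt f `|` spt g) (spt chi) H f pi.
    by apply: tame_le tf; rewrite /H; lra.
  have {}tg : tame a b (spt f `|` spt g) (spt chi) H g pi.
    by apply: tame_le tg; rewrite /H; lra.
  have [D [D1 HD]] := exists_approximates a01 b01 fr.
  have DH0 : 0 < D * H by rewrite mulr_gt0// (lt_le_trans ltr01).
  pose H1 := (`|s| + 1) * (D * H).
  have DH1 : D * H <= H1 by rewrite ler_peMl ?(ltW DH0)// lerDr.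
  have HH1 : H <= H1 by rewrite (le_trans _ DH1)// ler_peMl ?(ltW H0).
  have [C [C0 HC]] := ext_approx cK fr (lt_le_trans H0 HH1).
  apply: (geometric_bound_eq (C := (2 + `|s|) * C) (rate01 ab)) => k.
  (* One [rho] is used with both [gf] and [gg], as linearity of [T] needs common arguments. *)
  have [gf [rho [[agf arho] _ _ _]]] := HD _ _ _ H0 tf k.
  have [gg [_ [[agg _] _ _ _]]] := HD _ _ _ H0 tg k.
  have agf' := approx_fun_le (@subsetUl _ _ (spt g)) (lexx _) agf.
  have agg' := approx_fun_le (@subsetUr _ (spt f) _) (lexx _) agg.
  have ar j := approx_arg_le (@subset_refl _ W) DH1 (arho j).
  apply: (geometric_combination (x' := T (fun x => s * gf x + gg x) rho)
    (y' := T gf rho) (z' := T gg rho)).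
  + by rewrite mulr_ge0.
  + have [hgf hrho] := approx_dom cK (conj agf' arho).
    have [hgg _] := approx_dom cK (conj agg' arho).
    by rewrite Tlin.1.
  + apply: HC; last by split=> //; apply: approx_fun_lin => //; exact: ltW.
    by apply: tame_le tl; apply: le_trans HH1; rewrite /H; lra.
  + by apply: HC; [exact: tame_le tf|split=> //; exact: approx_fun_le agf'].
  + by apply: HC; [exact: tame_le tg|split=> //; exact: approx_fun_le agg'].
- have cK : compact (spt f) by case: hf.
  have [chi [W [fr cchi _]]] := exists_frame cK openT (@subsetT _ _).
  have hd r : hoelder_loc (b i) r -> hoelder_dom a b f (dfwith pi i r).
    by move=> hr; split=> //; exact: hoelder_loc_dfwith.
  have [Hp Hp0 tp] := exists_tame a01 b01 (hd _ hp) (@subset_refl _ _) cchi.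
  have [Hq Hq0 tq] := exists_tame a01 b01 (hd _ hq) (@subset_refl _ _) cchi.
  have [Hl Hl0 tl] := exists_tame a01 b01 (hd _ (hoelder_loc_lin s hp hq))
    (@subset_refl _ _) cchi.
  pose H := Hp + Hq + Hl; have H0 : 0 < H by rewrite !addr_gt0.
  have {}tp : tame a b (spt f) (spt chi) H f (dfwith pi i p).
    by apply: tame_le tp; rewrite /H; lra.
  have {}tq : tame a b (spt f) (spt chi) H f (dfwith pi i q).
    by apply: tame_le tq; rewrite /H; lra.
  have [D [D1 HD]] := exists_approximates a01 b01 fr.
  have DH0 : 0 < D * H by rewrite mulr_gt0// (lt_le_trans ltr01).
  pose H1 := (`|s| + 1) * (D * H).
  have DH1 : D * H <= H1 by rewrite ler_peMl ?(ltW DH0)// lerDr.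
  have HH1 : H <= H1 by rewrite (le_trans _ DH1)// ler_peMl ?(ltW H0).
  have [C [C0 HC]] := ext_approx cK fr (lt_le_trans H0 HH1).
  apply: (geometric_bound_eq (C := (2 + `|s|) * C) (rate01 ab)) => k.
  have [g [rho [[ag arho] _ _ _]]] := HD _ _ _ H0 tp k.
  (* Only slot [i] of [rho'] is taken; the other entries of both families are those of [pi], and [g]
     is shared. *)
  have [_ [rho' [[_ arho'] _ _ _]]] := HD _ _ _ H0 tq k.
  have ap := arho i; have aq := arho' i; rewrite !dfwithin in ap aq.
  have ar j := approx_arg_le (@subset_refl _ W) DH1 (arho j).
  have ag' := approx_fun_le (@subset_refl _ (spt f)) DH1 ag.
  have [hg hrho] := approx_dom cK (conj ag arho).
  have ardf r p' : approx_arg W H1 (scale k) (b i) p' r -> forall j,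
      approx_arg W H1 (scale k) (b j) (dfwith pi i p' j) (dfwith rho i r j).
    move=> apr j; have := approx_arg_dfwith ar apr j.
    by rewrite dfwith_dfwith.
  apply: (geometric_combination
    (x' := T g (dfwith rho i (fun x => s * rho i x + rho' i x)))
    (y' := T g (dfwith rho i (rho i))) (z' := T g (dfwith rho i (rho' i)))).
  + by rewrite mulr_ge0.
  + rewrite Tlin.2//.
    by have [br _ _] := arho' i; exact: bounded_lip_loc1.
  + apply: HC; first by apply: tame_le tl; apply: le_trans HH1; rewrite /H; lra.
    by split=> //; apply: ardf; exact: approx_arg_lin.
  + apply: HC; first exact: tame_le tp.
    by split=> //; apply: ardf; exact: approx_arg_le ap.
  + apply: HC; first exact: tame_le tq.
    by split=> //; apply: ardf; exact: approx_arg_le aq.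
Qed.

(** With the frame inside [U], the constant [s] is itself an admissible approximation of [pi i] at
    every scale, and [T] vanishes on it. *)
Lemma extension_local : local_on a b ext.
Proof.
move=> f pi [hf hpi] [i [U [s [oU fU Us]]]].
have cK : compact (spt f) by case: hf.
have [chi [W [fr cchi Wchi]]] := exists_frame cK oU fU.
have [H H0 tf] := exists_tame a01 b01 (conj hf hpi) (@subset_refl _ _) cchi.
have [D [D1 HD]] := exists_approximates a01 b01 fr.
have DH0 : 0 < D * H by rewrite mulr_gt0// (lt_le_trans ltr01).
have HDH : H <= D * H by rewrite ler_peMl ?(ltW H0).
have [C [C0 HC]] := ext_approx cK fr DH0.
apply/esym; apply: (geometric_bound_eq (C := C) (rate01 ab)) => k.
have [g [rho [ag _ _ _]]] := HD _ _ _ H0 tf k.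
have gdom := approx_dom cK ag; have [agf arho] := ag.
rewrite -[X in X - _](functional_cst Tloc i s gdom).
apply: HC; first exact: tame_le tf.
split=> // j; rewrite dfwithE; case: eqVneq => [<-|//]; split.
- exact: bounded_lip_cst.
- move=> x y _ _; rewrite subrr normr0 !mulr_ge0 ?powR_ge0 ?(ltW H0)//.
  exact: le_trans ler01 D1.
- move=> x /Wchi cx; have [[_ _ _ chiU] _ _ _] := fr.
  by rewrite (Us _ (chiU _ cx)) subrr normr0 mulr_ge0 ?powR_ge0 ?(ltW DH0).
Qed.

(* A Lipschitz pair approximates itself at every scale [e <= 1], because
   [e `^ (c - 1) >= 1]. *)
Lemma extension_lip f pi : hoelder_dom 1 (fun=> 1) f pi -> ext f pi = T f pi.
Proof.
move=> [hf hpi]; have cK : compact (spt f) by case: hf.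
have [[Cf [Cf0 fC fL]] _] := (hoelder_c_lip f).1 hf.
have [chi [W [fr cchi Wchi]]] := exists_frame cK openT (@subsetT _ _).
have [bchi oW KW chi1] := fr.
have [D [D1 HD]] := plateau_hoelderM bchi.
have one01 : 0 < (1 : R) <= 1 by rewrite ltr01 lexx.
have /choice[L HL] : forall i, exists L, 0 < L /\ tame_arg (spt chi) L 1 (pi i).
  move=> i; have [L [L0 pL pb]] := hoelder_loc_compact ltr01 (hpi i) cchi.
  by exists L.
have L0 i : 0 <= L i by have [/ltW] := HL i.
pose pi' i x := chi x * pi i x.
have pi'L i : (forall x, `|pi' i x| <= L i) /\
    hoelder_bound (D * L i) 1 setT (pi' i).
  by have [Li0 [pL pb]] := HL i; exact: HD.
have bpi' i : bounded_lip (pi' i).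
  by have [h1 h2] := pi'L i; exact: bounded_lipW h1 h2.
have D0 : 0 <= D by exact: le_trans ler01 D1.
(* [3 Cf] and [3 L i] are the Hölder constants that [lip_hoelder] gives for [f] and [pi i]; [D L i]
   bounds the Lipschitz constant of the cut-off [pi' i]. *)
pose H := Cf *+ 3 + (D + 3) * \sum_i L i.
have LH i : (D + 3) * L i <= H.
  rewrite /H (bigD1 i)//= mulrDr [leRHS]addrCA lerDl addr_ge0//.
    by rewrite mulrn_wge0// ltW.
  by rewrite mulr_ge0 ?addr_ge0// sumr_ge0.
have fH : Cf *+ 2 + Cf <= H.
  by rewrite -mulrSr lerDl mulr_ge0 ?addr_ge0// sumr_ge0.
have fH' : Cf <= H by rewrite (le_trans _ fH)// lerDr mulrn_wge0// ltW.
have H0 : 0 < H by exact: lt_le_trans fH'.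
have tf : tame a b (spt f) (spt chi) H f pi.
  split => //.
    split=> [x _|]; first by rewrite (le_trans (fC x)).
    apply: hoelder_bound_le fH _.
    by apply: lip_hoelder fL => //; exact: ltW.
  move=> i; have [Li0 [pL pb]] := HL i; split.
    by move=> x /pL px; rewrite (le_trans px)// (le_trans _ (LH i))// ler_peMl//; lra.
  apply: hoelder_bound_le (LH i) _.
  apply: hoelder_bound_le (lip_hoelder (b01 i) (L0 i) pL pb).
  by rewrite mulrDl -mulrSr -[_ *+ 3]mulr_natl lerDr mulr_ge0.
have [C [C0 HC]] := ext_approx cK fr H0.
have e1 c k : 0 < c <= 1 -> 1 <= scale k `^ (c - 1) :> R.
  move=> /andP[_ c1]; rewrite -[leLHS](powRr0 (scale k)).
  by apply: ger_powR; rewrite ?scale01// subr_le0.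
have -> : T f pi = T f pi'.
  apply: (functional_local Tlin Tloc) oW KW _ => //.
    by move=> i; exact: bounded_lip_loc1.
  by move=> i x /chi1 cx; rewrite /pi' cx mul1r.
apply/esym; apply: (geometric_bound_eq (C := C) (rate01 ab)) => k.
apply: HC => //; split.
  split=> //.
  - by move=> x; rewrite (le_trans (fC x)).
  - by apply: hoelder_bound_le fL; rewrite (le_trans fH')// ler_peMr ?e1// ltW.
  - by move=> x; rewrite subrr normr0 mulr_ge0 ?powR_ge0// ltW.
move=> i; split => //.
- apply: hoelder_bound_le (pi'L i).2.
  rewrite (@le_trans _ _ H)//; last by rewrite ler_peMr ?e1// ltW.
  by rewrite (le_trans _ (LH i))// mulrDl lerDl mulr_ge0.
- move=> x /chi1 cx; rewrite /pi' cx mul1r subrr normr0.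
  by rewrite mulr_ge0 ?powR_ge0// ltW.
Qed.

End extension_properties.

(** * Continuity and uniqueness of the extension *)

Section extension_continuity.
Context {R : realType} {X : metricType R} {n : nat}.
Variables (a : R) (b : 'I_n -> R) (T : functional X n).
Hypotheses (lcX : locally_compact [set: X]) (a01 : 0 < a <= 1)
  (b01 : forall i, 0 < b i <= 1) (ab : n%:R < a + \sum_i b i)
  (nT : locally_normal T).
Implicit Types (f g p r : X -> R) (pi rho : 'I_n -> X -> R)
  (K A U W : set X) (c e H D C : R).

Let ext_approx := extension_approx lcX a01 b01 ab nT.
Let ext := extension a b T.

Lemma dist_chain (x y z d e : R) : `|y - z| <= e -> `|x - y| <= d ->
  `|x - z| <= d + e.
Proof.
move=> yz xy; rewrite -(subrK y x) -addrA (le_trans (ler_normD _ _))//.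
exact: lerD.
Qed.

Lemma hoelder_const_bound A c C f : (hoelder_const c A f <= C%:E)%E ->
  hoelder_bound `|C| c A f.
Proof.
move=> fC; apply/hoelder_constP => //; apply: le_trans fC _.
by rewrite lee_fin ler_norm.
Qed.

(** The Hölder constants are bounded for all [j], but the sup bounds come from being within [1] of
    the limit, hence hold only for large [j]. *)
Lemma hoelder_cvg_tame K A (f_ : nat -> X -> R)
    (pi_ : nat -> 'I_n -> X -> R) f pi : compact A ->
  (forall j, spt (f_ j) `<=` K) -> spt f `<=` K ->
  hoelder_dom a b f pi -> hoelder_cvg a b f_ pi_ f pi ->
  exists2 H, 0 < H & tame a b K A H f pi /\
    \forall j \near \oo, tame a b K A H (f_ j) (pi_ j).
Proof.
move=> cA fK fK' hdom [uf [Cf fCf] _ upi].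
have [H0 H00 tf] := exists_tame a01 b01 hdom fK' cA.
have /choice[L HL] : forall i, exists L : R, forall j,
    hoelder_bound `|L| (b i) A (pi_ j i).
  move=> i; have [[L HL] _] := upi A i cA.
  by exists L => j; exact: hoelder_const_bound.
have sL0 : 0 <= \sum_i `|L i| by exact: sumr_ge0.
pose H := H0 + 1 + `|Cf| + \sum_i `|L i|.
have Cf0 : 0 <= `|Cf| by [].
have HH : H0 + 1 <= H by rewrite /H; lra.
exists H; first by rewrite /H; lra.
split; first by apply: tame_le tf; rewrite /H; lra.
have [_ [fH0 _] piH0] := tf.
have /filter_forall pi1 : forall i, \forall j \near \oo,
    forall x, A x -> `|pi_ j i x - pi i x| <= 1.
  move=> i; have [_ /uniform_cvgP] := upi A i cA.
  by apply.
have f1 : \forall j \near \oo, forall x, setT x -> `|f_ j x - f x| <= 1.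
  by move/uniform_cvgP : uf; apply.
near=> j.
have close (s t : R) : `|t| <= H0 -> `|s - t| <= 1 -> `|s| <= H.
  move=> tH st; rewrite -(subrK t s) (le_trans (ler_normD _ _))//.
  by rewrite (le_trans _ HH)// addrC lerD.
split => //.
- split=> [x _|].
    apply: (close _ (f x)); first exact: fH0.
    by move: x; near: j; apply: filterS f1 => j + x; apply.
  apply: hoelder_bound_le (hoelder_const_bound (fCf j)).
  by rewrite /H; lra.
- move=> i; split=> [x Ax|].
    apply: (close _ (pi i x)); first by have [h _] := piH0 i; exact: h.
    move: i x Ax; near: j; apply: filterS pi1 => j h i x Ax; exact: h.
  apply: hoelder_bound_le (HL i j).
  rewrite /H (bigD1 i)//= -!addrA; rewrite (addrCA _ `|L i|).
  have : 0 <= \sum_(i0 | i0 != i) `|L i0| by exact: sumr_ge0.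
  by lra.
Unshelve. all: by end_near.
Qed.

(** Fix a scale [k] and an approximation [(g, rho)] of the limit. Once [f_j] and [pi_j] are within
    [scale k] to the power [a] or [b i] of it, the same [(g, rho)] approximates them with constant
    [D H + 1]; both values of the extension then lie within [C rate^k] of [T g rho]. *)
Lemma extension_continuous : continuous_on a b ext.
Proof.
move=> f_ pi_ f pi _ hdom hcvg; have [uf _ [K cK fK] upi] := hcvg.
have fK' : spt f `<=` K.
  apply: spt_subset; first exact: closed_compact.
  move=> x Kx; apply/eqP; rewrite -normr_le0; apply/ler_addgt0Pl => e e0.
  move/uniform_cvgP : uf => /(_ e e0)[N _ /(_ N (leqnn N) x I)].
  rewrite spt_notin; last by move=> /fK.
  by rewrite sub0r normrN addr0.
have [chi [W [fr cchi Wchi]]] := exists_frame lcX cK openT (@subsetT _ _).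
have [H H0 [tf tf_]] := hoelder_cvg_tame cchi fK fK' hdom hcvg.
have [D [D1 HD]] := exists_approximates a01 b01 fr.
have D0 : 0 < D by exact: lt_le_trans D1.
have DH0 : 0 < D * H by rewrite mulr_gt0.
have DH1 : D * H <= D * H + 1 by rewrite lerDl.
have HH1 : H <= D * H + 1 by rewrite (le_trans _ DH1)// ler_peMl ?(ltW H0).
have [C [C0 HC]] := ext_approx cK fr (lt_le_trans H0 HH1).
apply/cvgrPdist_le => e e0.
have /andP[r0 r1] := rate01 ab.
have : (fun k => C * 2 * rate a b ^+ k) @ \oo --> 0.
  by apply: cvg_geometric; rewrite ger0_norm// ltW.
move=> /cvgrPdist_le/(_ e e0)[k _ /(_ k (leqnn k))].
rewrite sub0r normrN => /(le_trans (ler_norm _)) ke.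
have [g [rho [ag _ _ _]]] := HD _ _ _ H0 tf k.
have {}ag := approx_le fK' (@subset_refl _ W) (lexx _) ag.
have [[gK gH gL gf] arho] := ag.
have sk0 c : 0 < scale k `^ c :> R by rewrite powR_gt0// scale_gt0.
have f1 : \forall j \near \oo, forall x, setT x ->
    `|f_ j x - f x| <= scale k `^ a.
  by move/uniform_cvgP : uf; apply.
have /filter_forall pi1 : forall i, \forall j \near \oo,
    forall x, spt chi x -> `|pi_ j i x - pi i x| <= scale k `^ b i.
  by move=> i; have [_ /uniform_cvgP] := upi _ i cchi; apply.
near=> j.
have tj : tame a b K (spt chi) (D * H + 1) (f_ j) (pi_ j).
  by apply: tame_le HH1 _; near: j.
have fj : forall x, setT x -> `|f_ j x - f x| <= scale k `^ a by near: j.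
have pij : forall i x, spt chi x -> `|pi_ j i x - pi i x| <= scale k `^ b i.
  by near: j.
have aj : approximates a b K W (D * H + 1) (scale k) (f_ j) (pi_ j) g rho.
  split; last first.
    move=> i; have [br rL rp] := approx_arg_le (@subset_refl _ W) DH1 (arho i).
    split => // x Wx; have [_ _ /(_ x Wx)] := arho i; have := pij i x (Wchi x Wx).
    by rewrite mulrDl mul1r distrC; exact: dist_chain.
  have [_ gH' gL' _] := approx_fun_le (@subset_refl _ K) DH1 ag.1.
  split => // x; have := gf x; have := fj x I.
  by rewrite mulrDl mul1r distrC; exact: dist_chain.
have h1 := HC _ _ tj k _ _ aj.
have h2 := HC _ _ (tame_le HH1 tf) k _ _
  (approx_le (@subset_refl _ K) (@subset_refl _ W) DH1 ag).
apply: le_trans ke; rewrite -mulrA [2 * _]mulrC mulrA mulr_natr mulr2n.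
rewrite -[ext f pi](subrK (T g rho)) -addrA (le_trans (ler_normD _ _))//.
by rewrite lerD// distrC.
Unshelve. all: by end_near.
Qed.

(** Smoothed pairs converge to [(f, chi pi)] with bounded Hölder constants, so continuity determines
    [T'] there from its values on Lipschitz pairs, where it equals [T]. *)
Lemma extension_unique (T' : functional X n) f pi :
  hoelder_extension a b T T' -> hoelder_dom a b f pi -> T' f pi = ext f pi.
Proof.
move=> [T'T T'lin T'loc T'cont] hdom; have [hf hpi] := hdom.
have cK : compact (spt f) by case: hf.
have [chi [W [fr cchi Wchi]]] := exists_frame lcX cK openT (@subsetT _ _).
have [bchi oW KW chi1] := fr.
have [H H0 tf] := exists_tame a01 b01 hdom (@subset_refl _ _) cchi.
have [D' [D1' HD']] := plateau_hoelderM bchi.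
pose pi' i x := chi x * pi i x.
have hpi' : hoelder_loc_fam b pi'.
  move=> i; have [_ _ /(_ i)[pH pb]] := tf.
  by have [_] := HD' _ _ _ (b01 i) H0 pH pb; exact: hoelder_bound_loc.
(* The [rho_ k] approach [pi] only on [W] but [pi'] on all of [X], and continuity asks for
   convergence on every compact set. *)
have -> : T' f pi = T' f pi'.
  apply: (functional_local T'lin T'loc) oW KW _ => //.
  by move=> i x /chi1 cx; rewrite /pi' cx mul1r.
have [D [D1 HD]] := exists_approximates a01 b01 fr.
have DH0 : 0 < D * H by rewrite mulr_gt0// (lt_le_trans ltr01).
have HDH : H <= D * H by rewrite ler_peMl ?(ltW H0).
have [C [C0 HC]] := ext_approx cK fr DH0.
have /choice[g_ /choice[rho_ Hk]] := HD H f pi H0 tf.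
have lim1 : T (g_ k) (rho_ k) @[k --> \oo] --> ext f pi.
  apply: (cvg_geometric_bound (C := C) (rate01 ab)) => k.
  by apply: HC; [exact: tame_le tf|have [] := Hk k].
have dom1 k : hoelder_dom 1 (fun=> 1) (g_ k) (rho_ k).
  by have [h _ _ _] := Hk k; exact: approx_dom cK h.
have lim2 : T' (g_ k) (rho_ k) @[k --> \oo] --> T' f pi'.
  apply: T'cont => //.
  - move=> k; have [_ ga rb _] := Hk k; split.
      by split; [exists (D * H)|have [[]] := dom1 k].
    by move=> i; exact: hoelder_bound_loc (rb i).
  - split.
    + apply/uniform_cvgP => e e0; have /andP[a0 _] := a01.
      apply: filterS (scale_small (D * H) a0 e0) => k ke x _.
      by have [[[_ _ _ gf] _] _ _ _] := Hk k; rewrite (le_trans (gf x)).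
    + exists (D * H) => k; apply/hoelder_constP; first exact: ltW.
      by have [] := Hk k.
    + exists (spt f) => // k.
      by have [[[]]] := Hk k.
    + move=> A i cA; split.
        exists (D * H) => k; apply/hoelder_constP; first exact: ltW.
        by have [_ _ /(_ i) h _] := Hk k; exact: hoelder_bound_sub h.
      apply/uniform_cvgP => e e0; have /andP[b0 _] := b01 i.
      apply: filterS (scale_small (D * H) b0 e0) => k ke x _.
      by have [_ _ _ h] := Hk k; rewrite (le_trans (h i x)).
have E : (fun k => T' (g_ k) (rho_ k)) = (fun k => T (g_ k) (rho_ k)).
  by apply/funext => k; exact: T'T.
rewrite E in lim2.
by rewrite -(cvg_lim (@Rhausdorff R) lim2); exact: cvg_lim lim1.
Qed.

End extension_continuity.

Theorem theorem4p2 (R : realType) (X : metricType R) (n : nat)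
    (a : R) (b : 'I_n -> R) (T : functional X n) :
  locally_compact [set: X] ->
  0 < a <= 1 -> (forall i, 0 < b i <= 1) -> n%:R < a + \sum_i b i ->
  locally_normal T ->
  exists Tbar : functional X n,
    hoelder_extension a b T Tbar /\
    forall Tbar' : functional X n, hoelder_extension a b T Tbar' ->
      forall f pi, hoelder_dom a b f pi -> Tbar' f pi = Tbar f pi.
Proof.
move=> lcX a01 b01 ab nT; exists (extension a b T); split.
  split; first exact: extension_lip.
  - exact: extension_multilinear.
  - exact: extension_local.
  - exact: extension_continuous.
by move=> T' eT' f pi; exact: extension_unique.
Qed.
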